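(* Let $L$ be a finite-dimensional nontrivial $\omega$-Lie algebra over $\mathbb{C}$ with $\dim L\ge 3$. Then, up to isomorphism, $L$ is one of the following. (1) $\dim L=3$, and $L$ is one of $L_1$, $L_2$, $A_\alpha$ ($\alpha\in\mathbb{C}$), $B$, $C_\alpha$ ($\alpha\in\mathbb{C}$, $\alpha\neq 0,-1$), as listed in the context. (2) $\dim L=4$, and $L$ is one of $L_{1,i}$ ($i=1,\dots,8$), $L_{2,i}$ ($i=1,2,3,4$), $E_{1,\alpha}$ ($\alpha\ne 0,1$), $F_{1,\alpha}$ ($\alpha\neq 0,1$), $G_{1,\alpha}$, $H_{1,\alpha}$, $\widetilde{A_\alpha}$, $\widetilde{B}$, $\widetilde{C_\alpha}$ ($\alpha\ne 0,-1$), with $\alpha\in\mathbb{C}$, as listed in the context. (3) ($NP_1$-type) $\dim L\ge 5$, $L=H\oplus\mathbb{C}x\oplus\mathbb{C}v$ as a vector space, and the nonzero brackets and values of $\omega$ are, for $h\in H$, $$[x,v]=h_1+x,\quad [x,h]=f(h),\quad [v,h]=g(h),\quad \omega(x,v)=1,$$ where $h_1\in H$ and $f,g:H\to H$ are linear maps whose matrices $A$ and $B$ with respect to a suitable basis of $H$ satisfy $A=I+A'$ and $[A',B]=A'$, where $A'$ is strictly upper triangular and $B$ is upper triangular. (4) ($P_1$-type) $\dim L\ge 5$, $L=\mathbb{C}h_0\oplus H_1\oplus\mathbb{C}x\oplus\mathbb{C}v$ as a vector space, and the nonzero brackets and values of $\omega$ are, for $h\in H_1$, $$[x,h_0]=-ah_0,\quad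 [v,h]=\tfrac1a h,\quad [v,h_0]=h_2+\tfrac1a h_0+x,\quad [x,v]=h_1+av,\quad \omega(x,v)=1,$$ where $h_1\in\mathbb{C}h_0\oplus H_1$, $h_2\in H_1$ and $0\ne a\in\mathbb{C}$. (5) ($NP_2$-type) $\dim L\ge5$, $L=H\oplus\mathbb{C}x\oplus\mathbb{C}y\oplus\mathbb{C}a$ as a vector space, and the nonzero brackets and values of $\omega$ are, for $h\in H$, $$[a,h]=h,\quad [x,h]=f(h),\quad [y,h]=g(h),\quad [y,a]=h_2,$$ $$[x,y]=h_3+d_1x-b_2d_1y+a,\quad [x,a]=h_1-x+b_2y,\quad \omega(x,y)=1,$$ where $h_1,h_2,h_3\in H$, $b_2,d_1\in\mathbb{C}$, and $f,g:H\to H$ are linear. (6) ($NP_3$-type) $\dim L\ge5$, $L=H\oplus\mathbb{C}x\oplus\mathbb{C}y\oplus\mathbb{C}a$ as a vector space, and the nonzero brackets and values of $\omega$ are, for $h\in H$, $$[a,h]=h,\quad [x,h]=f(h),\quad [y,a]=h_2-y,$$ $$[x,a]=h_1+b_2y,\quad [x,y]=h_3+d_2y+a,\quad \omega(x,y)=1,$$ where $h_1,h_2,h_3\in H$, $b_2,d_2\in\mathbb{C}$, $f:H\to H$ is linear, and $f(h_2)=d_2h_2$. (7) ($P_2$-type) $\dim L\ge5$, $L=H\oplus\mathbb{C}x\oplus\mathbb{C}y\oplus\mathbb{C}a$ as a vector space, and the nonzero brackets and values of $\omega$ are, for $h\in H$, $$[a,h]=h,\quad [x,y]=h_3+a,\quad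 [x,a]=h_1+b_1x+b_2y,\quad [y,a]=h_2+c_1y,\quad \omega(x,y)=1,$$ where $h_1,h_2,h_3\in H$, $b_1,b_2,c_1\in\mathbb{C}$, $b_1\neq0$, $c_1\neq0$ and $b_1+c_1+1=0$. (8) ($NP_4$-type) $\dim L\ge5$, $L=H\oplus\mathbb{C}x\oplus\mathbb{C}y\oplus\mathbb{C}a$ as a vector space, and the nonzero brackets and values of $\omega$ are, for $h\in H$, $$[a,h]=h,\quad [x,h]=\lambda(h)y+f(h),\quad [y,a]=-y,$$ $$[x,a]=c_2y+h_4,\quad [x,y]=d_1y+a+h_3,\quad \omega(x,y)=1,$$ where $h_3,h_4\in H$, $c_2,d_1\in\mathbb{C}$, $\lambda:H\to\mathbb{C}$ is a nonzero linear functional, and $f:H\to H$ is linear.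
   Context: All vector spaces and algebras are finite-dimensional over $\mathbb{C}$. An $\omega$-Lie algebra is a vector space $L$ with a bilinear map $[\cdot,\cdot]:L\times L\to L$ and a skew-symmetric bilinear form $\omega:L\times L\to\mathbb{C}$ such that for all $x,y,z\in L$: $[x,y]=-[y,x]$ and $$[[x,y],z]+[[y,z],x]+[[z,x],y]=\omega(x,y)z+\omega(y,z)x+\omega(z,x)y.$$ It is called nontrivial if $\omega\ne0$. An isomorphism is a linear bijection preserving the bracket and $\omega$. Convention on ''the nonzero brackets and values of $\omega$'': the bracket and $\omega$ are determined by the listed values together with bilinearity and skew-symmetry, and all brackets and values of $\omega$ between summands or basis elements that are not listed (up to skew-symmetry) are zero; in particular $[H,H]=0$ in cases (3), (5)–(8) and $[\mathbb{C}h_0\oplus H_1,\mathbb{C}h_0\oplus H_1]=0$ in case (4). Here $H$, $H_1$ denote linear subspaces of $L$, and $x,y,v,a,h_0$ denote nonzero vectors spanning the indicated lines (in case (4), $a$ is a scalar). Three-dimensional algebras (basis $x,y,z$): - $L_1$: $[y,z]=z$, $[x,y]=y$, $\omega(x,y)=1$. - $L_2$: $[x,z]=y$, $[y,z]=z$, $\omega(x,z)=1$. - $A_\alpha$ ($\alpha\in\mathbb{C}$): $[x,y]=x$, $[x,z]=x+y$, $[y,z]=z+\alpha x$, $\omega(y,z)=-1$. - $B$: $[x,y]=y$, $[x,z]=y+z$, $[y,z]=x$, $\omega(y,z)=2$. - $C_\alpha$ ($\alpha\in\mathbb{C}$, $\alpha\ne0,-1$): $[x,y]=y$, $[x,z]=\alpha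 z$, $[y,z]=x$, $\omega(y,z)=1+\alpha$. Four-dimensional algebras (basis $x,y,z,e$): - $L_{1,1}$: $[x,y]=y$, $[y,z]=z$, $[e,y]=-e$, $\omega(x,y)=1$. - $L_{1,2}$: $[x,y]=y$, $[y,z]=z$, $[e,x]=z$, $[e,y]=-e$, $\omega(x,y)=1$. - $L_{1,3}$: $[x,y]=y$, $[y,z]=z$, $[e,x]=y$, $[e,y]=-e$, $\omega(x,y)=1$, $\omega(e,x)=1$. - $L_{1,4}$: $[x,y]=y$, $[y,z]=z$, $[e,x]=y+z$, $[e,y]=-e$, $\omega(x,y)=1$, $\omega(e,x)=1$. - $L_{1,5}$: $[x,y]=y$, $[y,z]=z$, $[e,x]=e$, $[e,y]=-e$, $\omega(x,y)=1$. - $L_{1,6}$: $[x,y]=y$, $[y,z]=z$, $[e,x]=e+y$, $[e,y]=-e$, $\omega(x,y)=1$, $\omega(e,x)=1$. - $L_{1,7}$: $[x,y]=y$, $[y,z]=z$, $[e,x]=e$, $[e,y]=z-e$, $\omega(x,y)=1$. - $L_{1,8}$: $[x,y]=y$, $[y,z]=z$, $[e,x]=e+y$, $[e,y]=z-e$, $\omega(x,y)=1$, $\omega(e,x)=1$. - $L_{2,1}$: $[x,z]=y$, $[y,z]=z$, $[e,y]=-e$, $\omega(x,z)=1$. - $L_{2,2}$: $[x,z]=y$, $[y,z]=z$, $[e,y]=-e$, $[e,x]=z$, $\omega(x,z)=1$. - $L_{2,3}$: $[x,z]=y$, $[y,z]=z$, $[e,y]=-e$, $[e,x]=e$, $\omega(x,z)=1$.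 - $L_{2,4}$: $[x,z]=y$, $[y,z]=z$, $[e,y]=-e$, $[e,x]=e+z$, $\omega(x,z)=1$. - $E_{1,\alpha}$ ($\alpha\ne0,1$): $[x,y]=y$, $[y,z]=z$, $[e,x]=\alpha e$, $[e,y]=-e$, $\omega(x,y)=1$. - $F_{1,\alpha}$ ($\alpha\neq0,1$): $[x,y]=y$, $[y,z]=z$, $[e,y]=-e$, $[e,x]=\alpha e+y$, $\omega(x,y)=1$, $\omega(e,x)=1$. - $G_{1,\alpha}$: $[e,x]=e+\alpha y$, $[e,y]=-e+x$, $[y,z]=z$, $[x,y]=y$, $\omega(e,x)=\alpha$, $\omega(x,y)=1$. - $H_{1,\alpha}$: $[e,x]=e+\alpha y$, $[e,y]=-e+x+z$, $[y,z]=z$, $[x,y]=y$, $\omega(e,x)=\alpha$, $\omega(x,y)=1$. - $\widetilde{A_\alpha}$: $[x,y]=x$, $[x,z]=x+y$, $[y,z]=z+\alpha x$, $[e,z]=e$, $\omega(y,z)=-1$. - $\widetilde{B}$: $[x,y]=y$, $[x,z]=y+z$, $[y,z]=x$, $[e,x]=-2e$, $\omega(y,z)=2$. - $\widetilde{C_\alpha}$ ($\alpha\ne0,-1$): $[x,y]=y$, $[x,z]=\alpha z$, $[y,z]=x$, $[e,x]=-(1+\alpha)e$, $\omega(y,z)=1+\alpha$. *)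

(* Defs.v *)
From HB Require Import structures.
From mathcomp Require Import all_boot all_order all_algebra.
From mathcomp Require Import complex reals.

Set Implicit Arguments.
Unset Strict Implicit.
Unset Printing Implicit Defensive.

Import GRing.Theory.
Local Open Scope ring_scope.

(* [omegaAlg F] carries only the raw data; the axioms are in [omega_lie]. *)
Record omegaAlg (F : fieldType) := OmegaAlg {
  carrier :> vectType F;
  br : carrier -> carrier -> carrier;
  om : carrier -> carrier -> F }.

Section OmegaLie.
Variable F : fieldType.
Implicit Types L M : omegaAlg F.

Record omega_lie L : Prop := OmegaLie {
  br_linearr : forall u : L, linear (br u);
  br_linearl : forall v : L, linear (fun u : L => br u v);
  om_linearr : forall u : L, scalar (om u);
  om_linearl : forall v : L, scalar (fun u : L => om u v);
  br_skew : forall u v : L, br u v = - br v u;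
  om_skew : forall u v : L, om u v = - om v u;
  omega_jacobi : forall u v w : L,
    br (br u v) w + br (br v w) u + br (br w u) v
    = om u v *: w + om v w *: u + om w u *: v }.

Definition nontrivial L : Prop := exists u v : L, om u v != 0.

Definition omega_iso L M : Prop :=
  exists phi : 'Hom(L, M),
    [/\ bijective phi,
        forall u v : L, phi (br u v) = br (phi u) (phi v)
      & forall u v : L, om (phi u) (phi v) = om u v].

(* The algebra with basis [ev i], i < n, where an entry (i, j, w) of [tb]
   stands for [ev i, ev j] = w and an entry (i, j, c) of [tw] stands for
   omega(ev i, ev j) = c; the operations are the bilinear skew-symmetric
   extensions of these values, and all pairs not listed go to 0. *)
Definition ev n (i : 'I_n) : 'rV[F]_n := delta_mx 0 i.

Definition table_br n (tb : seq ('I_n * 'I_n * 'rV[F]_n)) (u v : 'rV[F]_n) :=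
  \sum_(t <- tb)
    (u 0 t.1.1 * v 0 t.1.2 - u 0 t.1.2 * v 0 t.1.1) *: t.2.

Definition table_om n (tw : seq ('I_n * 'I_n * F)) (u v : 'rV[F]_n) : F :=
  \sum_(t <- tw) (u 0 t.1.1 * v 0 t.1.2 - u 0 t.1.2 * v 0 t.1.1) * t.2.

Definition table_alg n (tb : seq ('I_n * 'I_n * 'rV[F]_n))
    (tw : seq ('I_n * 'I_n * F)) : omegaAlg F :=
  @OmegaAlg F 'rV[F]_n (table_br tb) (table_om tw).

End OmegaLie.

Section SmallAlgebras.
Variable F : fieldType.
Implicit Type alpha : F.

Local Notation "<< i >>" := (ev F i).

Section Dim3.
Let x : 'I_3 := @Ordinal 3 0 isT.
Let y : 'I_3 := @Ordinal 3 1 isT.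
Let z : 'I_3 := @Ordinal 3 2 isT.

Definition algL1 : omegaAlg F :=
  table_alg [:: (y, z, <<z>>); (x, y, <<y>>)] [:: (x, y, 1)].

Definition algL2 : omegaAlg F :=
  table_alg [:: (x, z, <<y>>); (y, z, <<z>>)] [:: (x, z, 1)].

Definition algA alpha : omegaAlg F :=
  table_alg [:: (x, y, <<x>>); (x, z, <<x>> + <<y>>);
                (y, z, <<z>> + alpha *: <<x>>)]
            [:: (y, z, -1)].

Definition algB : omegaAlg F :=
  table_alg [:: (x, y, <<y>>); (x, z, <<y>> + <<z>>); (y, z, <<x>>)]
            [:: (y, z, 2)].

Definition algC alpha : omegaAlg F :=
  table_alg [:: (x, y, <<y>>); (x, z, alpha *: <<z>>); (y, z, <<x>>)]
            [:: (y, z, 1 + alpha)].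
End Dim3.

Section Dim4.
Let x : 'I_4 := @Ordinal 4 0 isT.
Let y : 'I_4 := @Ordinal 4 1 isT.
Let z : 'I_4 := @Ordinal 4 2 isT.
Let e : 'I_4 := @Ordinal 4 3 isT.

Definition algL1_1 : omegaAlg F :=
  table_alg [:: (x, y, <<y>>); (y, z, <<z>>); (e, y, - <<e>>)]
            [:: (x, y, 1)].

Definition algL1_2 : omegaAlg F :=
  table_alg [:: (x, y, <<y>>); (y, z, <<z>>); (e, x, <<z>>); (e, y, - <<e>>)]
            [:: (x, y, 1)].

Definition algL1_3 : omegaAlg F :=
  table_alg [:: (x, y, <<y>>); (y, z, <<z>>); (e, x, <<y>>); (e, y, - <<e>>)]
            [:: (x, y, 1); (e, x, 1)].

Definition algL1_4 : omegaAlg F :=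
  table_alg [:: (x, y, <<y>>); (y, z, <<z>>); (e, x, <<y>> + <<z>>);
                (e, y, - <<e>>)]
            [:: (x, y, 1); (e, x, 1)].

Definition algL1_5 : omegaAlg F :=
  table_alg [:: (x, y, <<y>>); (y, z, <<z>>); (e, x, <<e>>); (e, y, - <<e>>)]
            [:: (x, y, 1)].

Definition algL1_6 : omegaAlg F :=
  table_alg [:: (x, y, <<y>>); (y, z, <<z>>); (e, x, <<e>> + <<y>>);
                (e, y, - <<e>>)]
            [:: (x, y, 1); (e, x, 1)].

Definition algL1_7 : omegaAlg F :=
  table_alg [:: (x, y, <<y>>); (y, z, <<z>>); (e, x, <<e>>);
                (e, y, <<z>> - <<e>>)]
            [:: (x, y, 1)].

Definition algL1_8 : omegaAlg F :=
  table_alg [:: (x, y, <<y>>); (y, z, <<z>>); (e, x, <<e>> + <<y>>);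
                (e, y, <<z>> - <<e>>)]
            [:: (x, y, 1); (e, x, 1)].

Definition algL2_1 : omegaAlg F :=
  table_alg [:: (x, z, <<y>>); (y, z, <<z>>); (e, y, - <<e>>)]
            [:: (x, z, 1)].

Definition algL2_2 : omegaAlg F :=
  table_alg [:: (x, z, <<y>>); (y, z, <<z>>); (e, y, - <<e>>); (e, x, <<z>>)]
            [:: (x, z, 1)].

Definition algL2_3 : omegaAlg F :=
  table_alg [:: (x, z, <<y>>); (y, z, <<z>>); (e, y, - <<e>>); (e, x, <<e>>)]
            [:: (x, z, 1)].

Definition algL2_4 : omegaAlg F :=
  table_alg [:: (x, z, <<y>>); (y, z, <<z>>); (e, y, - <<e>>);
                (e, x, <<e>> + <<z>>)]
            [:: (x, z, 1)].

Definition algE1 alpha : omegaAlg F :=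
  table_alg [:: (x, y, <<y>>); (y, z, <<z>>); (e, x, alpha *: <<e>>);
                (e, y, - <<e>>)]
            [:: (x, y, 1)].

Definition algF1 alpha : omegaAlg F :=
  table_alg [:: (x, y, <<y>>); (y, z, <<z>>); (e, y, - <<e>>);
                (e, x, alpha *: <<e>> + <<y>>)]
            [:: (x, y, 1); (e, x, 1)].

Definition algG1 alpha : omegaAlg F :=
  table_alg [:: (e, x, <<e>> + alpha *: <<y>>); (e, y, - <<e>> + <<x>>);
                (y, z, <<z>>); (x, y, <<y>>)]
            [:: (e, x, alpha); (x, y, 1)].

Definition algH1 alpha : omegaAlg F :=
  table_alg [:: (e, x, <<e>> + alpha *: <<y>>);
                (e, y, - <<e>> + <<x>> + <<z>>); (y, z, <<z>>); (x, y, <<y>>)]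
            [:: (e, x, alpha); (x, y, 1)].

Definition algAt alpha : omegaAlg F :=
  table_alg [:: (x, y, <<x>>); (x, z, <<x>> + <<y>>);
                (y, z, <<z>> + alpha *: <<x>>); (e, z, <<e>>)]
            [:: (y, z, -1)].

Definition algBt : omegaAlg F :=
  table_alg [:: (x, y, <<y>>); (x, z, <<y>> + <<z>>); (y, z, <<x>>);
                (e, x, - 2 *: <<e>>)]
            [:: (y, z, 2)].

Definition algCt alpha : omegaAlg F :=
  table_alg [:: (x, y, <<y>>); (x, z, alpha *: <<z>>); (y, z, <<x>>);
                (e, x, - (1 + alpha) *: <<e>>)]
            [:: (y, z, 1 + alpha)].
End Dim4.

Definition classified3 (L : omegaAlg F) : Prop :=
  omega_iso L algL1 \/
  omega_iso L algL2 \/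
  (exists alpha, omega_iso L (algA alpha)) \/
  omega_iso L algB \/
  (exists alpha, [/\ alpha != 0, alpha != -1 & omega_iso L (algC alpha)]).

Definition classified4 (L : omegaAlg F) : Prop :=
  omega_iso L algL1_1 \/
  omega_iso L algL1_2 \/
  omega_iso L algL1_3 \/
  omega_iso L algL1_4 \/
  omega_iso L algL1_5 \/
  omega_iso L algL1_6 \/
  omega_iso L algL1_7 \/
  omega_iso L algL1_8 \/
  omega_iso L algL2_1 \/
  omega_iso L algL2_2 \/
  omega_iso L algL2_3 \/
  omega_iso L algL2_4 \/
  (exists alpha, [/\ alpha != 0, alpha != 1 & omega_iso L (algE1 alpha)]) \/
  (exists alpha, [/\ alpha != 0, alpha != 1 & omega_iso L (algF1 alpha)]) \/
  (exists alpha, omega_iso L (algG1 alpha)) \/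
  (exists alpha, omega_iso L (algH1 alpha)) \/
  (exists alpha, omega_iso L (algAt alpha)) \/
  omega_iso L algBt \/
  (exists alpha, [/\ alpha != 0, alpha != -1 & omega_iso L (algCt alpha)]).

End SmallAlgebras.

Section Types.
Variables (F : fieldType) (L : omegaAlg F).

Definition null_on (H : {vspace L}) : Prop :=
  {in H &, forall h h' : L, br h h' = 0 /\ om h h' = 0}.

Definition om_null (u : L) (H : {vspace L}) : Prop :=
  {in H, forall h : L, om u h = 0}.

Definition br_null (u : L) (H : {vspace L}) : Prop :=
  {in H, forall h : L, br u h = 0}.

(* L = H (+) F x (+) F v with x, v nonzero *)
Definition dsum2 (H : {vspace L}) (x v : L) : Prop :=
  [/\ x != 0, v != 0, directv (H + <[x]> + <[v]>)
    & (H + <[x]> + <[v]>)%VS = fullv].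

Definition dsum3 (H : {vspace L}) (x y a : L) : Prop :=
  [/\ x != 0, y != 0, a != 0, directv (H + <[x]> + <[y]> + <[a]>)
    & (H + <[x]> + <[y]> + <[a]>)%VS = fullv].

(* Matrix of f in the basis b, acting on column vectors: column j lists the
   coordinates of f b_j. (The library's [mxof] is the transpose.) *)
Definition mat_of (V : vectType F) n (b : n.-tuple V) (f : 'End(V)) : 'M[F]_n :=
  \matrix_(i, j) coord b i (f b`_j).

Definition upper_tri n (A : 'M[F]_n) : Prop :=
  forall i j : 'I_n, (j < i)%N -> A i j = 0.

Definition strict_upper_tri n (A : 'M[F]_n) : Prop :=
  forall i j : 'I_n, (j <= i)%N -> A i j = 0.

Definition NP1_type : Prop :=
  exists (H : {vspace L}) (x v h1 : L) (f g : 'End(subvs_of H)),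
    [/\ dsum2 H x v, h1 \in H,
        [/\ br x v = h1 + x,
            forall h : subvs_of H, br x (vsval h) = vsval (f h),
            forall h : subvs_of H, br v (vsval h) = vsval (g h)
          & om x v = 1],
        [/\ null_on H, om_null x H & om_null v H]
      & exists (b : (\dim H).-tuple (subvs_of H)) (A' : 'M[F]_(\dim H)),
          let B := mat_of b g in
          [/\ basis_of fullv b,
              mat_of b f = 1%:M + A',
              A' *m B - B *m A' = A',
              strict_upper_tri A'
            & upper_tri B]].

Definition P1_type : Prop :=
  exists (H1 : {vspace L}) (h0 x v h1 h2 : L) (a : F),
    [/\ [/\ h0 != 0, x != 0, v != 0,
            directv (<[h0]> + H1 + <[x]> + <[v]>)
          & (<[h0]> + H1 + <[x]> + <[v]>)%VS = fullv],
        [/\ h1 \in (<[h0]> + H1)%VS, h2 \in H1 & a != 0],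
        [/\ br x h0 = - a *: h0,
            {in H1, forall h, br v h = a^-1 *: h},
            br v h0 = h2 + a^-1 *: h0 + x,
            br x v = h1 + a *: v
          & om x v = 1]
      & [/\ br_null x H1, null_on (<[h0]> + H1),
            om_null x (<[h0]> + H1) & om_null v (<[h0]> + H1)]].

(* The part shared by the types below: L = H (+) F x (+) F y (+) F a,
   [a, h] = h, omega(x, y) = 1, and omega and [H, H] vanish elsewhere. *)
Definition xya_frame (H : {vspace L}) (x y a : L) : Prop :=
  [/\ dsum3 H x y a,
      {in H, forall h, br a h = h},
      om x y = 1,
      [/\ om x a = 0 & om y a = 0]
    & [/\ null_on H, om_null x H, om_null y H & om_null a H]].

Definition NP2_type : Prop :=
  exists (H : {vspace L}) (x y a h1 h2 h3 : L) (b2 d1 : F)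
      (f g : 'End(subvs_of H)),
    [/\ xya_frame H x y a,
        [/\ h1 \in H, h2 \in H & h3 \in H]
      & [/\ forall h : subvs_of H, br x (vsval h) = vsval (f h),
            forall h : subvs_of H, br y (vsval h) = vsval (g h),
            br y a = h2,
            br x y = h3 + d1 *: x - (b2 * d1) *: y + a
          & br x a = h1 - x + b2 *: y]].

Definition NP3_type : Prop :=
  exists (H : {vspace L}) (x y a : L) (h1 h2 h3 : subvs_of H) (b2 d2 : F)
      (f : 'End(subvs_of H)),
    [/\ xya_frame H x y a,
        [/\ forall h : subvs_of H, br x (vsval h) = vsval (f h),
            br y a = vsval h2 - y,
            br x a = vsval h1 + b2 *: y
          & br x y = vsval h3 + d2 *: y + a],
        br_null y H
      & f h2 = d2 *: h2].

Definition P2_type : Prop :=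
  exists (H : {vspace L}) (x y a h1 h2 h3 : L) (b1 b2 c1 : F),
    [/\ xya_frame H x y a,
        [/\ h1 \in H, h2 \in H & h3 \in H],
        [/\ b1 != 0, c1 != 0 & b1 + c1 + 1 = 0],
        [/\ br x y = h3 + a,
            br x a = h1 + b1 *: x + b2 *: y
          & br y a = h2 + c1 *: y]
      & br_null x H /\ br_null y H].

Definition NP4_type : Prop :=
  exists (H : {vspace L}) (x y a h3 h4 : L) (c2 d1 : F)
      (lambda : 'Hom(subvs_of H, F^o)) (f : 'End(subvs_of H)),
    [/\ xya_frame H x y a,
        [/\ h3 \in H, h4 \in H & lambda != 0],
        [/\ forall h : subvs_of H,
              br x (vsval h) = (lambda h : F) *: y + vsval (f h),
            br y a = - y,
            br x a = c2 *: y + h4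
          & br x y = d1 *: y + a + h3]
      & br_null y H].

End Types.

(* Main.v *)
(* The trace of the omega-Jacobi identity shows that om(u, v) = lam [u, v], where
   lam(u) = tr(ad u) / (dim L - 2). Combined with the identity satisfied by the
   Jacobian of any anticommutative algebra, this makes om of rank 2 and gives
   [h, k] = lam(h) k - lam(k) h on its radical R, which has codimension 2.

   If lam vanishes on R, then R is abelian; either it is an ideal on which x and v
   act by a pair with [f - 1, g] = f - 1, hence simultaneously triangularizable
   (NP1), or [x, R] is not contained in R and the Jacobi identity leaves P1.
   Otherwise R = C a + H with H = R /\ ker lam and ad a = 1 on H. The element a
   acts on L / R with trace -1: when its eigenvalues are nonzero we are in P2, and
   when they are 0 and -1 in NP2 or NP4, according to whether H is an ideal.

   These normal forms hold in every dimension at least 3; in dimensions 3 and 4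
   explicit changes of basis identify them with the listed algebras. *)

Require Import Defs.
From HB Require Import structures.
From mathcomp Require Import all_boot all_order all_algebra.
From mathcomp Require Import complex reals.
From mathcomp Require Import ring.

Set Implicit Arguments.
Unset Strict Implicit.
Unset Printing Implicit Defensive.

Import GRing.Theory Num.Theory VectorInternalTheory.
Local Open Scope ring_scope.

(** When [lam] is nonzero on R, the case division comes from the eigenvalues of u -> [u, a]: it is
    -1 on H, and modulo R its two eigenvalues add up to -1. By the Jacobi identity, bracketing with
    an element of H lowers an eigenvalue by 1. So [x, h] or [y, h] can leave H only if the
    eigenvalues on L / R differ by 1, and with sum -1 they must then be 0 and -1: this is why
    exactly these values are exceptional. When [lam] vanishes on R, the obstruction to R being an
    ideal is one linear form p on R, the v-component of [x, h]. The Jacobi identity on x and two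
    elements of R gives p(h) [v, k] = p(k) [v, h], so p nonzero leaves v an action of rank one on R.
    The intermediate normal forms carry further consequences of the Jacobi identity; in dimension 4,
    where H has dimension at most 2, these decide which listed algebra occurs. *)

Section Functionals.
Variables (F : fieldType) (V : vectType F).

(** Turns an identity between vectors into identities between scalars, to which [ring] and [field]
    apply; [by_functionals] packages this. *)
Lemma functional_ext (u v : V) : (forall phi : {scalar V}, phi u = phi v) -> u = v.
Proof.
move=> uv; rewrite (coord_vbasis (memvf u)) (coord_vbasis (memvf v)).
by apply: eq_bigr => i _; congr (_ *: _); exact: (uv (coord (vbasis fullv) i)).
Qed.

End Functionals.

(** Proof by linear combination: [c = d] is a combination of known equations, assembled with [eqD],
    [eqB] and [eqM], and [ring] checks that it differs from the goal by a formal identity. *)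
Lemma eq_comb (R : zmodType) (a b c d : R) : c = d -> a - b = c - d -> a = b.
Proof. by move=> ->; rewrite subrr => /eqP; rewrite subr_eq0 => /eqP. Qed.

Lemma eqD (R : zmodType) (a b c d : R) : a = b -> c = d -> a + c = b + d.
Proof. by move=> -> ->. Qed.

Lemma eqB (R : zmodType) (a b c d : R) : a = b -> c = d -> a - c = b - d.
Proof. by move=> -> ->. Qed.

Lemma eqM (R : pzRingType) (k a b : R) : a = b -> k * a = k * b.
Proof. by move=> ->. Qed.

Ltac by_functionals :=
  apply: functional_ext => ?; rewrite ?(linear0, linearD, linearB, linearN, linearZ) /=.

(** * Bilinear calculus, exactness of [om], and the four-term identity *)

Section OmegaLieTheory.
Variables (F : numClosedFieldType) (L : omegaAlg F).
Hypothesis Ll : omega_lie L.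
Implicit Types (u v w x y z h a : L) (c : F).

Local Notation "[[ u , v ]]" := (br u v) (at level 0, format "[[ u ,  v ]]").

Lemma brDl u v w : [[u + v, w]] = [[u, w]] + [[v, w]].
Proof. by have := br_linearl Ll w 1 u v; rewrite !scale1r. Qed.
Lemma br0l w : [[0, w]] = 0.
Proof. by apply: (@addrI _ [[0, w]]); rewrite -brDl !addr0. Qed.
Lemma brZl c u w : [[c *: u, w]] = c *: [[u, w]].
Proof. by have := br_linearl Ll w c u 0; rewrite /= br0l !addr0. Qed.
Lemma brNl u w : [[- u, w]] = - [[u, w]].
Proof. by rewrite -!scaleN1r brZl. Qed.
Lemma brDr u v w : [[w, u + v]] = [[w, u]] + [[w, v]].
Proof. by have := br_linearr Ll w 1 u v; rewrite !scale1r. Qed.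
Lemma br0r w : [[w, 0]] = 0.
Proof. by apply: (@addrI _ [[w, 0]]); rewrite -brDr !addr0. Qed.
Lemma brZr c u w : [[w, c *: u]] = c *: [[w, u]].
Proof. by have := br_linearr Ll w c u 0; rewrite br0r !addr0. Qed.
Lemma brNr u w : [[w, - u]] = - [[w, u]].
Proof. by rewrite -!scaleN1r brZr. Qed.
Lemma brC u v : [[u, v]] = - [[v, u]].
Proof. exact: br_skew Ll u v. Qed.
Lemma brxx u : [[u, u]] = 0.
Proof.
have := brC u u; move/eqP; rewrite -addr_eq0 -mulr2n -scaler_nat scaler_eq0.
by rewrite pnatr_eq0 /= => /eqP.
Qed.

Lemma omDl u v w : om (u + v) w = om u w + om v w.
Proof. by have := om_linearl Ll w 1 u v; rewrite scale1r mul1r. Qed.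
Lemma om0l w : om (0 : L) w = 0.
Proof. by apply: (@addrI _ (om (0 : L) w)); rewrite -omDl !addr0. Qed.
Lemma omZl c u w : om (c *: u) w = c * om u w.
Proof. by have := om_linearl Ll w c u 0; rewrite /= om0l !addr0. Qed.
Lemma omNl u w : om (- u) w = - om u w.
Proof. by rewrite -scaleN1r omZl mulN1r. Qed.
Lemma omDr u v w : om w (u + v) = om w u + om w v.
Proof. by have := om_linearr Ll w 1 u v; rewrite scale1r mul1r. Qed.
Lemma om0r w : om w 0 = 0.
Proof. by apply: (@addrI _ (om w 0)); rewrite -omDr !addr0. Qed.
Lemma omZr c u w : om w (c *: u) = c * om w u.
Proof. by have := om_linearr Ll w c u 0; rewrite om0r !addr0. Qed.
Lemma omNr u w : om w (- u) = - om w u.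
Proof. by rewrite -scaleN1r omZr mulN1r. Qed.
Lemma omC u v : om u v = - om v u.
Proof. exact: om_skew Ll u v. Qed.
Lemma omxx u : om u u = 0.
Proof.
have := omC u u; move/eqP; rewrite -addr_eq0 -mulr2n -mulr_natl mulf_eq0.
by rewrite pnatr_eq0 /= => /eqP.
Qed.

Lemma br_sumr I (r : seq I) (P : pred I) (f : I -> L) w :
  [[w, \sum_(i <- r | P i) f i]] = \sum_(i <- r | P i) [[w, f i]].
Proof. exact: (big_morph (br w) (fun u v => brDr u v w) (br0r w)). Qed.
Lemma br_suml I (r : seq I) (P : pred I) (f : I -> L) w :
  [[\sum_(i <- r | P i) f i, w]] = \sum_(i <- r | P i) [[f i, w]].
Proof. by apply: (big_morph (fun u : L => [[u, w]])) => [u v|]; rewrite ?brDl ?br0l. Qed.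
Lemma om_sumr I (r : seq I) (P : pred I) (f : I -> L) w :
  om w (\sum_(i <- r | P i) f i) = \sum_(i <- r | P i) om w (f i).
Proof. exact: (big_morph (om w) (fun u v => omDr u v w) (om0r w)). Qed.
Lemma om_suml I (r : seq I) (P : pred I) (f : I -> L) w :
  om (\sum_(i <- r | P i) f i) w = \sum_(i <- r | P i) om (f i) w.
Proof. by apply: (big_morph (fun u : L => om u w)) => [u v|]; rewrite ?omDl ?om0l. Qed.

Definition brE := (brDl, brDr, brZl, brZr, brNl, brNr, br0l, br0r, brxx).
Definition omE := (omDl, omDr, omZl, omZr, omNl, omNr, om0l, om0r, omxx).

Lemma om_exact : (2 < \dim {:L})%N ->
  exists lam : {scalar L}, forall u v, om u v = lam [[u, v]].
Proof.
set n : nat := \dim {:L} => n_gt2.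
set b := vbasis {:L}.
pose tr u : F := \sum_(i < n) coord b i [[u, b`_i]].
have trl : scalar tr.
  move=> c u v; rewrite /tr mulr_sumr -big_split /=; apply: eq_bigr => i _.
  by rewrite brDl brZl linearD linearZ.
pose T : {scalar L} := HB.pack tr (GRing.isLinear.Build _ _ _ _ _ trl).
have coordE w : w = \sum_i coord b i w *: b`_i by apply: coord_vbasis; rewrite memvf.
pose adM u v := \sum_i coord b i [[u, [[v, b`_i]]]].
have adMC u v : adM u v = adM v u.
  have E w1 w2 : adM w1 w2 =
      \sum_(i < n) \sum_(j < n) coord b j [[w2, b`_i]] * coord b i [[w1, b`_j]].
    apply: eq_bigr => i _; rewrite {1}(coordE [[w2, b`_i]]) br_sumr linear_sum /=.
    by apply: eq_bigr => j _; rewrite brZr linearZ.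
  rewrite !E exchange_big /=.
  by apply: eq_bigr => i _; apply: eq_bigr => j _; rewrite mulrC.
have omT u v : \sum_(i < n) om v b`_i * coord b i u = om v u.
  rewrite {2}(coordE u) om_sumr.
  by apply: eq_bigr => i _; rewrite omZr mulrC.
have bfree : free b := basis_free (vbasisP _).
have n2 : (n%:R - 2 : F) != 0.
  by rewrite subr_eq0 eqr_nat; apply/eqP => e; move: n_gt2; rewrite e.
(* Trace of w -> [[u, v], w], expanded by the Jacobi identity: the two double brackets have equal
   trace by [adMC], the multiple of the identity contributes n om(u, v), and each of the two
   rank-one terms contributes - om(u, v). *)
have key u v : T [[u, v]] = (n%:R - 2) * om u v.
  have -> : T [[u, v]] = \sum_(i < n) (coord b i [[u, [[v, b`_i]]]] - coord b i [[v, [[u, b`_i]]]]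
      + om u v * 1 + om v b`_i * coord b i u - om u b`_i * coord b i v).
    apply: eq_bigr => i _; set w := b`_i.
    have -> : [[ [[u, v]], w]] = [[u, [[v, w]]]] - [[v, [[u, w]]]] + om u v *: w
         + om v w *: u - om u w *: v.
      have -> : [[ [[u, v]], w]] = om u v *: w + om v w *: u + om w u *: v
          - [[ [[w, u]], v]] - [[ [[v, w]], u]].
        by rewrite -(omega_jacobi Ll) !addrK.
      rewrite (brC u) (brC [[w, u]]) (brC w u) (omC w u) !brNr.
      by by_functionals; ring.
    rewrite !linearD !linearN /= !linearZ /=.
    by rewrite coord_free // eqxx.
  rewrite !big_split /= !sumrN -!mulr_sumr -/(adM u v) -/(adM v u) adMC !omT.
  rewrite sumr_const card_ord (omC v u); ring.
have laml : scalar (fun u => (n%:R - 2)^-1 * tr u).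
  by move=> c u v; rewrite /= trl mulrDr mulrCA.
pose lam : {scalar L} := HB.pack (fun u => (n%:R - 2)^-1 * tr u)
  (GRing.isLinear.Build _ _ _ _ _ laml).
exists lam => u v /=; rewrite -[tr _]/(T _).
by rewrite key mulrA mulVf // mul1r.
Qed.

Variable lam : {scalar L}.
Hypothesis lamE : forall u v, om u v = lam [[u, v]].

Lemma lam_cocycle x y z :
  om [[x, y]] z + om [[y, z]] x + om [[z, x]] y
  = om x y * lam z + om y z * lam x + om z x * lam y.
Proof. by rewrite !(lamE [[_, _]]) -!linearD (omega_jacobi Ll) !linearD !linearZ. Qed.

(* In every anticommutative algebra the Jacobian J satisfies
   sum sgn [J(x, y, z), t] = sum sgn J([x, y], z, t). Here each product
   om(x, y)[z, t] occurs twice on the left and once on the right. *)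
Lemma four_term x y z t :
  om x y *: [[z, t]] + om z t *: [[x, y]] - om x z *: [[y, t]]
    - om y t *: [[x, z]] + om x t *: [[y, z]] + om y z *: [[x, t]]
  = (om x y * lam z + om y z * lam x + om z x * lam y) *: t
    - (om x y * lam t + om y t * lam x + om t x * lam y) *: z
    + (om x z * lam t + om z t * lam x + om t x * lam z) *: y
    - (om y z * lam t + om z t * lam y + om t y * lam z) *: x.
Proof.
rewrite -!lam_cocycle; apply: functional_ext => phi.
have H (a b c d : L) : phi [[ [[ [[a, b]], c]], d]] - phi [[ [[c, d]], [[b, a]] ]]
    - phi [[ [[ [[a, b]], d]], c]]
    = om [[a, b]] c * phi d + om c d * phi [[a, b]] - om [[a, b]] d * phi c.
  have := congr1 phi (omega_jacobi Ll [[a, b]] c d).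
  rewrite !linearD !linearZ /= (brC b a) (brC d [[a, b]]) (omC d [[a, b]]).
  rewrite !(brNl, brNr) !linearN /=.
  by rewrite opprK mulNr.
have K (a b c d : L) : phi [[ [[ [[a, b]], c]], d]] + phi [[ [[ [[b, c]], a]], d]]
    + phi [[ [[ [[c, a]], b]], d]]
    = om a b * phi [[c, d]] + om b c * phi [[a, d]] + om c a * phi [[b, d]].
  have := congr1 (fun s => phi [[s, d]]) (omega_jacobi Ll a b c).
  by rewrite !(brDl, brZl) !linearD !linearZ.
(* [E1] is the signed sum of [H] over the six pairs, [E2] that of [K] over the four triples. The
   triple brackets agree, and the brackets of two brackets cancel between complementary pairs, so
   only terms containing [om] remain in the difference. *)
pose E1 := eqD (eqB (eqB (H x y z t) (H x z y t)) (eqD (H x t z y) (H y z t x)))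
  (eqB (H z t x y) (H y t x z)).
pose E2 := eqB (eqB (K x y z t) (K x y t z)) (eqB (K y z t x) (K x z t y)).
apply: (eq_comb (eqB E1 E2)).
rewrite !(linearD, linearB, linearN, linearZ) /=.
rewrite ?(brC _ x) ?(brC z y) ?(brC t y) ?(brC t z) ?(omC _ x) ?(omC z y) ?(omC t y) ?(omC t z).
rewrite !(brNl, brNr, omNl) (brC [[z, t]] [[x, y]]) (brC [[y, t]] [[x, z]]) (brC [[y, z]] [[x, t]]).
rewrite !linearN /=.
ring.
Qed.
End OmegaLieTheory.

(** * Recognizing an algebra given by a table *)

Section TableIso.
Variables (F : numClosedFieldType) (L : omegaAlg F).
Hypothesis Ll : omega_lie L.
Variables (n : nat) (tb : seq ('I_n * 'I_n * 'rV[F]_n)) (tw : seq ('I_n * 'I_n * F)).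

(** Bilinearity of a single table entry; summing over the table gives the expansions of both
    operations on unit vectors. *)
Lemma minor_expand (u v : 'rV[F]_n) (k l : 'I_n) :
  u 0 k * v 0 l - u 0 l * v 0 k = \sum_i \sum_j u 0 i * v 0 j *
    (ev F i 0 k * ev F j 0 l - ev F i 0 l * ev F j 0 k).
Proof.
have E (a b : 'I_n) : u 0 a * v 0 b = \sum_i \sum_j u 0 i * v 0 j * (ev F i 0 a * ev F j 0 b).
  rewrite (bigD1 a) //= (bigD1 b) //= !mxE !eqxx !mulr1 !big1 ?addr0 // => i ni.
    by apply: big1 => j _; rewrite !mxE [a == i]eq_sym (negPf ni) mul0r mulr0.
  by rewrite !mxE [b == i]eq_sym (negPf ni) !mulr0.
rewrite !E -sumrB; apply: eq_bigr => i _; rewrite -sumrB; apply: eq_bigr => j _.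
by rewrite mulrBr.
Qed.

Lemma table_brE u v : table_br tb u v
  = \sum_i \sum_j (u 0 i * v 0 j) *: table_br tb (ev F i) (ev F j).
Proof.
rewrite [LHS]/table_br.
under [RHS]eq_bigr => i _.
  under eq_bigr => j _ do rewrite /table_br scaler_sumr.
  rewrite exchange_big; over.
rewrite exchange_big /=; apply: eq_bigr => t _.
under eq_bigr => i _.
  under eq_bigr => j _ do rewrite scalerA.
  rewrite -scaler_suml; over.
rewrite -scaler_suml; congr (_ *: _); exact: minor_expand.
Qed.

Lemma table_omE u v : table_om tw u v
  = \sum_i \sum_j (u 0 i * v 0 j) * table_om tw (ev F i) (ev F j).
Proof.
rewrite [LHS]/table_om.
under [RHS]eq_bigr => i _.
  under eq_bigr => j _ do rewrite /table_om mulr_sumr.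
  rewrite exchange_big; over.
rewrite exchange_big /=; apply: eq_bigr => t _.
under eq_bigr => i _.
  under eq_bigr => j _ do rewrite mulrA.
  rewrite -mulr_suml; over.
rewrite -mulr_suml; congr (_ * _); exact: minor_expand.
Qed.

Lemma table_brC u v : table_br tb u v = - table_br tb v u.
Proof.
rewrite -sumrN; apply: eq_bigr => t _; rewrite -scaleNr; congr (_ *: _).
ring.
Qed.

Lemma table_omC u v : table_om tw u v = - table_om tw v u.
Proof.
rewrite -sumrN; apply: eq_bigr => t _; ring.
Qed.

Lemma table_iso (b : n.-tuple L) : basis_of fullv b ->
  (forall i j : 'I_n, (i < j)%N ->
     br b`_i b`_j = \sum_k table_br tb (ev F i) (ev F j) 0 k *: b`_k) ->
  (forall i j : 'I_n, (i < j)%N -> om b`_i b`_j = table_om tw (ev F i) (ev F j)) ->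
  omega_iso L (table_alg tb tw).
Proof.
move=> bb hbr hom.
have skew0 (V : lmodType F) (a : V) : a = - a -> a = 0.
  move/eqP; rewrite -addr_eq0 -mulr2n -scaler_nat scaler_eq0.
  by rewrite pnatr_eq0 /= => /eqP.
have {}hbr (i j : 'I_n) :
    br b`_i b`_j = \sum_k table_br tb (ev F i) (ev F j) 0 k *: b`_k.
  case: (ltngtP i j) => [/hbr // | ji | /val_inj ->].
    rewrite (brC Ll) hbr // -sumrN; apply: eq_bigr => k _.
    by rewrite table_brC mxE scaleNr opprK.
  rewrite (brxx Ll) (skew0 _ _ (table_brC _ _)) big1 // => k _.
  by rewrite mxE scale0r.
have {}hom (i j : 'I_n) : om b`_i b`_j = table_om tw (ev F i) (ev F j).
  case: (ltngtP i j) => [/hom // | ji | /val_inj ->].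
    by rewrite (omC Ll) hom // table_omC opprK.
  by rewrite (omxx Ll) (skew0 F^o _ (table_omC _ _)).
pose crd (u : L) : 'rV[F]_n := \row_i coord b i u.
have crd_lin : linear crd.
  by move=> c u v; apply/rowP => i; rewrite !mxE linearP.
pose f : {linear L -> 'rV[F]_n} := HB.pack crd (GRing.isLinear.Build _ _ _ _ _ crd_lin).
have crdE u : u = \sum_i crd u 0 i *: b`_i.
  by rewrite {1}(coord_basis bb (memvf u)); apply: eq_bigr => i _; rewrite mxE.
have crdK (r : 'rV[F]_n) : f (\sum_i r 0 i *: b`_i) = r.
  by apply/rowP => i; rewrite mxE coord_sum_free // (basis_free bb).
have brE u v : br u v = \sum_i \sum_j (crd u 0 i * crd v 0 j) *: br b`_i b`_j.
  rewrite {1}(crdE u) {1}(crdE v) (br_suml Ll); apply: eq_bigr => i _.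
  rewrite (br_sumr Ll); apply: eq_bigr => j _.
  by rewrite (brZl Ll) (brZr Ll) scalerA.
have omE u v : om u v = \sum_i \sum_j (crd u 0 i * crd v 0 j) * om b`_i b`_j.
  rewrite {1}(crdE u) {1}(crdE v) (om_suml Ll); apply: eq_bigr => i _.
  rewrite (om_sumr Ll); apply: eq_bigr => j _.
  by rewrite (omZl Ll) (omZr Ll) mulrA.
exists (linfun f); split.
- exists (fun r : 'rV[F]_n => \sum_i r 0 i *: b`_i) => [u | r]; rewrite lfunE ?crdK //=.
- move=> u v; rewrite !lfunE /= table_brE brE -[crd (\sum_i _)]/(f _) linear_sum.
  apply: eq_bigr => i _; rewrite linear_sum; apply: eq_bigr => j _.
  by rewrite linearZ hbr crdK.
- move=> u v; rewrite !lfunE /= table_omE omE.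
  by apply: eq_bigr => i _; apply: eq_bigr => j _; rewrite hom.
Qed.

End TableIso.

Section TableEval.
Variables (F : numClosedFieldType) (L : omegaAlg F).
Hypothesis Ll : omega_lie L.
Variables (n : nat) (s : seq L).

Definition comb (r : 'rV[F]_n) : L := \sum_k r 0 k *: s`_k.

Lemma combD u v : comb (u + v) = comb u + comb v.
Proof. by rewrite -big_split; apply: eq_bigr => k _; rewrite mxE scalerDl. Qed.
Lemma combZ c u : comb (c *: u) = c *: comb u.
Proof. by rewrite scaler_sumr; apply: eq_bigr => k _; rewrite mxE scalerA. Qed.
Lemma combN u : comb (- u) = - comb u.
Proof. by rewrite -!scaleN1r combZ. Qed.
Lemma comb_ev (i : 'I_n) : comb (ev F i) = s`_i.
Proof.
rewrite /comb (bigD1 i) //= big1 ?mxE ?eqxx ?scale1r ?addr0 // => j ji.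
by rewrite mxE (negPf ji) scale0r.
Qed.
Definition combE := (combD, combZ, combN, comb_ev).

(* The value of a table at the basis vectors i < j, in a form that [simpl]
   evaluates when the table is concrete. *)
Fixpoint tab_entry (V : zmodType) (T : Type) (val : T -> V)
    (tb : seq ('I_n * 'I_n * T)) (i j : nat) : V :=
  if tb is t :: tb' then
    let r := tab_entry val tb' i j in
    if (nat_of_ord t.1.1 == i) && (nat_of_ord t.1.2 == j) then val t.2 + r
    else if (nat_of_ord t.1.1 == j) && (nat_of_ord t.1.2 == i) then - val t.2 + r
    else r
  else 0.

Lemma tab_entry_sum (V : lmodType F) (T : Type) (val : T -> V)
    (tb : seq ('I_n * 'I_n * T)) (i j : 'I_n) :
  (i < j)%N -> tab_entry val tb i j =
  \sum_(t <- tb) (ev F i 0 t.1.1 * ev F j 0 t.1.2 - ev F i 0 t.1.2 * ev F j 0 t.1.1) *: val t.2.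
Proof.
move=> ij; elim: tb => [|[[k l] v] tb IH]; first by rewrite big_nil.
rewrite big_cons /= IH; set S := bigop _ _ _; rewrite !mxE /=.
have E (a b : 'I_n) : (nat_of_ord a == b) = (a == b) by [].
rewrite !E; case: (k =P i) => [->|ki]; case: (l =P j) => [->|lj] /=.
- have nij : (j == i) = false by apply/negbTE; rewrite -val_eqE neq_ltn ij orbT.
  by rewrite nij /= mulr1 mul0r subr0 scale1r.
- case: (i =P j) => [e|_]; first by move: ij; rewrite e ltnn.
  by rewrite mulr0 mulr0 subr0 scale0r add0r.
- case: (j =P i) => [e|_]; first by move: ij; rewrite e ltnn.
  by rewrite andbF mul0r mul0r subr0 scale0r add0r.
- rewrite mul0r sub0r; case: (l =P i) => _; case: (k =P j) => _ /=;
  by rewrite ?(mulr1, mulr0, oppr0, scale0r, scaleN1r, add0r).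
Qed.

(** Entry point of all identifications: a spanning list of length dim L is a basis, and
    skew-symmetry leaves only the pairs i < j, on which a concrete table is evaluated by
    [tab_entry]. *)
Lemma table_iso_eval tb tw : size s = n -> \dim {:L} = n -> <<s>>%VS = fullv ->
  (forall i j, (i < j < n)%N -> br s`_i s`_j = tab_entry comb tb i j) ->
  (forall i j, (i < j < n)%N -> om s`_i s`_j = tab_entry id tw i j) ->
  omega_iso L (table_alg tb tw).
Proof.
move=> sn dn sp hbr hom.
have bs : basis_of fullv s by rewrite basisEdim sp subvv sn dn leqnn.
pose b : n.-tuple L := tcast sn (in_tuple s).
have bE : b = s :> seq L by rewrite /b val_tcast.
apply: (@table_iso _ _ Ll _ _ _ b); rewrite ?bE // => i j ij.
  rewrite hbr ?ij ?ltn_ord // tab_entry_sum // -[RHS]/(comb _).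
  have comb0 : comb 0 = 0 by rewrite -(scale0r 0) combZ scale0r.
  by rewrite (big_morph comb combD comb0); apply: eq_bigr => t _; rewrite combZ.
by rewrite hom ?ij ?ltn_ord // (@tab_entry_sum F^o).
Qed.
End TableEval.

(** * Direct sums with lines *)

Section DirectSums.
Variables (F : fieldType) (V : vectType F).
Implicit Types (U H : {vspace V}) (x y z : V).

Lemma directv_addline U x : x \notin U -> directv (U + <[x]>).
Proof.
move=> xU; apply/directv_addP/eqP; rewrite -subv0; apply/subvP => w.
rewrite memv_cap => /andP[wU /vlineP[k wk]]; rewrite memv0 wk scaler_eq0.
apply: contraNT xU; rewrite negb_or => /andP[k0 _].
by rewrite -[x]scale1r -(mulVf k0) -scalerA memvZ // -wk.
Qed.

Lemma directv_line2 H x y : x \notin H -> y \notin (H + <[x]>)%VS ->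
  directv (H + <[x]> + <[y]>).
Proof.
move=> xH yHx; rewrite directv_addE /= directv_addline //=.
by apply/andP; split; [exact: directv_trivial | exact/eqP/directv_addP/directv_addline].
Qed.

Lemma directv_line3 H x y z : x \notin H -> y \notin (H + <[x]>)%VS ->
  z \notin (H + <[x]> + <[y]>)%VS -> directv (H + <[x]> + <[y]> + <[z]>).
Proof.
move=> xH yHx zHxy; rewrite directv_addE /= directv_line2 //=.
by apply/andP; split; [exact: directv_trivial | exact/eqP/directv_addP/directv_addline].
Qed.

Lemma directv_lineH2 g H x y : g \notin H -> x \notin (<[g]> + H)%VS ->
  y \notin (<[g]> + H + <[x]>)%VS -> directv (<[g]> + H + <[x]> + <[y]>).
Proof.
move=> gH xgH yS; rewrite !directv_addE /=; apply/and3P; split.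
- apply/and3P; split; last exact/eqP/directv_addP/directv_addline.
    apply/and3P; split; [exact: directv_trivial | exact: directv_trivial |].
    by rewrite capvC; apply/eqP/directv_addP/directv_addline.
  exact: directv_trivial.
- exact: directv_trivial.
- exact/eqP/directv_addP/directv_addline.
Qed.

End DirectSums.

(** * Rank of [om] and the bracket on its radical *)

Section Radical.
Variables (F : numClosedFieldType) (L : omegaAlg F).
Hypothesis Ll : omega_lie L.
Variable lam : {scalar L}.
Hypothesis lamE : forall u v : L, om u v = lam (br u v).
Implicit Types (u v w x y z h a : L) (c : F).

(** The left side is the Pfaffian of [om] on four vectors. Applying [lam] to [four_term] gives twice
    this Pfaffian on the left, while the terms on the right cancel; hence [om] has rank at most
    2. *)
Lemma om_plucker x y z t :
  om x y * om z t - om x z * om y t + om x t * om y z = 0.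
Proof.
have := congr1 lam (four_term Ll lamE x y z t).
rewrite !(linearD, linearB, linearN, linearZ) /= -!lamE.
rewrite (omC Ll t x) (omC Ll z x) (omC Ll t y) => E.
have n2 : 2 != 0 :> F by rewrite pnatr_eq0.
by apply: (mulfI n2); apply: (eq_comb E); ring.
Qed.

Lemma exists_radical : nontrivial L -> exists (R : {vspace L}) (x y : L),
  om x y = 1 /\ (forall h, h \in R <-> forall u, om h u = 0).
Proof.
case=> x [y' xy']; pose y := (om x y')^-1 *: y'.
have xy : om x y = 1 by rewrite (omZr Ll) mulVf.
have oml w : linear (fun u : L => om w u : F^o).
  by move=> c u v; rewrite (omDr Ll) (omZr Ll).
pose f w : {linear L -> F^o} := HB.pack (fun u : L => om w u : F^o)
  (GRing.isLinear.Build _ _ _ _ _ (oml w)).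
(* Since om(x, y) = 1, [om_plucker] shows that a vector orthogonal to x and y is orthogonal to
   everything. *)
exists (lker (linfun (f x)) :&: lker (linfun (f y)))%VS, x, y; split=> // h.
rewrite memv_cap !memv_ker !lfunE /=; split=> [/andP[/eqP xh /eqP yh] u | h0].
  have := om_plucker x y h u.
  by rewrite xy xh (omC Ll y h) in yh *; rewrite yh mul1r mul0r mulr0 addr0 subr0.
by rewrite (omC Ll x) (omC Ll y) !h0 oppr0 eqxx.
Qed.

Variable R : {vspace L}.
Hypothesis RP : forall h, h \in R <-> forall u, om h u = 0.

Lemma rad_oml h u : h \in R -> om h u = 0.
Proof. by move/RP. Qed.

Lemma rad_omr h u : h \in R -> om u h = 0.
Proof. by move=> /RP hR; rewrite (omC Ll) hR oppr0. Qed.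

(** The left side is the trace of u -> [u, h] on L / R in the basis x, y; in [lam_cocycle] at h, x,
    y only this trace and the term om(x, y) lam(h) survive. *)
Lemma rad_trace x y h : om x y = 1 -> h \in R ->
  om (br x h) y + om x (br y h) = - lam h.
Proof.
move=> xy hR; have := lam_cocycle Ll lamE h x y.
rewrite !(rad_oml _ hR) !(rad_omr _ hR) xy (brC Ll h x) (omNl Ll) => E.
by rewrite (omC Ll x); apply: (eq_comb (esym E)); ring.
Qed.

Variables x y : L.
Hypothesis xy : om x y = 1.

Lemma rad_mod u : u - om u y *: x - om x u *: y \in R.
Proof.
apply/RP => w; have := om_plucker x y u w; rewrite xy.
rewrite !(omDl Ll, omNl Ll, omZl Ll) (omC Ll y u) => E.
by apply: (eq_comb E); ring.
Qed.

(** In [four_term] at x, y, h, k every value of [om] except om(x, y) = 1 has an argument in R. *)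
Lemma br_rad h k : h \in R -> k \in R -> br h k = lam h *: k - lam k *: h.
Proof.
move=> hR kR; have := four_term Ll lamE x y h k.
by rewrite !(rad_oml _ hR) !(rad_oml _ kR) !(rad_omr _ hR) !(rad_omr _ kR) xy
  !(scale0r, mul0r, mul1r, scale1r, addr0, add0r, subr0).
Qed.

Lemma rad_mem u : om u y = 0 -> om x u = 0 -> u \in R.
Proof. by move=> uy xu; have := rad_mod u; rewrite uy xu !scale0r !subr0. Qed.

Lemma rad_notin : x \notin R /\ y \notin (R + <[x]>)%VS.
Proof.
split; first by apply/negP => /RP /(_ y); rewrite xy => /eqP; rewrite oner_eq0.
apply/negP => /memv_addP[h /(rad_omr x) xh [_ /vlineP[k ->] yE]].
move: xy; rewrite yE (omDr Ll) xh (omZr Ll) (omxx Ll) mulr0 addr0 => /eqP.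
by rewrite eq_sym oner_eq0.
Qed.

Lemma rad_sum : (R + <[x]> + <[y]>)%VS = fullv.
Proof.
apply/eqP; rewrite eqEsubv subvf /=; apply/subvP => u _.
rewrite (_ : u = (u - om u y *: x - om x u *: y) + om u y *: x + om x u *: y); last first.
  by by_functionals; ring.
by rewrite !memv_add ?rad_mod // memvZ // memv_line.
Qed.

Lemma rad_dsum2 : dsum2 R x y.
Proof.
have [xR yR] := rad_notin; split; [| | exact: directv_line2 | exact: rad_sum].
- by apply: contraNneq xR => ->; rewrite mem0v.
- by apply: contraNneq yR => ->; rewrite mem0v.
Qed.

End Radical.

Section NormalForms.
Variables (F : fieldType) (L : omegaAlg F).

(* The normal forms reached below specialize the types of the statement: a = 1
   in P1, b2 = 0 in NP2, c2 = 0 in NP4. NP3 does not occur, since replacing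
   (x, y) by (y, -x) turns it into NP2. *)
Definition ideal_form : Prop :=
  exists (H : {vspace L}) (x v : L),
    [/\ dsum2 H x v, om x v = 1, [/\ null_on H, om_null x H & om_null v H],
        br x v - x \in H
      & [/\ {in H, forall h, br x h \in H}, {in H, forall h, br v h \in H}
          & {in H, forall h, br x h - br x (br v h) + br v (br x h) = h}]].

Definition P1_form : Prop :=
  exists (H1 : {vspace L}) (h0 x v h1 h2 : L),
    [/\ [/\ h0 != 0, x != 0, v != 0,
            directv (<[h0]> + H1 + <[x]> + <[v]>)
          & (<[h0]> + H1 + <[x]> + <[v]>)%VS = fullv],
        h1 \in (<[h0]> + H1)%VS /\ h2 \in H1,
        [/\ br x h0 = - h0, {in H1, forall h, br v h = h},
            br v h0 = h2 + h0 + x, br x v = h1 + v & om x v = 1]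
      & [/\ br_null x H1, null_on (<[h0]> + H1),
            om_null x (<[h0]> + H1) & om_null v (<[h0]> + H1)]].

Lemma P1_form_type : P1_form -> P1_type L.
Proof.
case=> H1 [h0 [x [v [h1 [h2 [Hsum [h1H h2H] [xh0 vh vh0 xv omxv] Hnull]]]]]].
exists H1, h0, x, v, h1, h2, 1; split=> //; first by split; rewrite ?oner_eq0.
split; rewrite ?invr1 ?scale1r //; first by rewrite scaleN1r.
by move=> h hH; rewrite scale1r vh.
Qed.

End NormalForms.

(** * The case where [lam] vanishes on the radical *)

Section AbelianRadical.
Variables (F : numClosedFieldType) (L : omegaAlg F).
Hypothesis Ll : omega_lie L.
Variable lam : {scalar L}.
Hypothesis lamE : forall u v : L, om u v = lam (br u v).
Implicit Types (u v w x y z h a : L) (c : F).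
Variable R : {vspace L}.
Hypothesis RP : forall h, h \in R <-> forall u, om h u = 0.
Hypothesis lamR : {in R, forall h, lam h = 0}.

Let rl := rad_oml RP.
Let rr := rad_omr Ll RP.

Lemma abelian_rad_br x y : om x y = 1 -> {in R &, forall h k, br h k = 0}.
Proof.
by move=> xy h k hR kR; rewrite (br_rad Ll lamE RP xy) // !lamR // !scale0r subr0.
Qed.

(** Here [lam] descends to L / R and is nonzero there, because lam([x, y]) = om(x, y) = 1. Take v
    spanning its kernel and x with lam(x) = 1: then [x, v] = x + c v modulo R, and replacing x by x
    + c v absorbs the last term without changing [x, v]. *)
Lemma abelian_rad_frame x y : om x y = 1 ->
  exists x' v, [/\ om x' v = 1, lam x' = 1, lam v = 0 & br x' v - x' \in R].
Proof.
move=> xy0.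
have [{x y xy0} x [y [xy lx]]] : exists x y, om x y = 1 /\ lam x != 0.
  have [lx|lx] := eqVneq (lam x) 0; last by exists x, y.
  have [ly|ly] := eqVneq (lam y) 0.
    have /eqP := xy0; rewrite lamE.
    have hR := rad_mod Ll lamE RP xy0 (br x y).
    have := lamR hR; rewrite !(linearB, linearZ) /= lx ly !mulr0 !subr0 => ->.
    by rewrite eq_sym oner_eq0.
  exists y, (- x); split=> //; by rewrite (omNr Ll) (omC Ll) opprK.
pose x1 := (lam x)^-1 *: x; pose v := lam x *: y - lam y *: x.
have x1v : om x1 v = 1.
  rewrite /x1 /v (omZl Ll) (omDr Ll) (omNr Ll) !(omZr Ll) (omxx Ll) xy; field.
  by [].
have lv : lam v = 0 by rewrite linearB !linearZ /=; ring.
have lx1 : lam x1 = 1 by rewrite linearZ /= mulVf.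
move: {xy lx} x1 v x1v lv lx1 => {y} x1 v x1v lv lx1.
pose c := om x1 (br x1 v); exists (x1 + c *: v), v.
have -> : br (x1 + c *: v) v = br x1 v by rewrite (brDl Ll) (brZl Ll) (brxx Ll) scaler0 addr0.
split.
- by rewrite (omDl Ll) (omZl Ll) (omxx Ll) mulr0 addr0.
- by rewrite linearD linearZ /= lv mulr0 addr0.
- by [].
have hR := rad_mod Ll lamE RP x1v (br x1 v).
have := lamR hR; rewrite !(linearB, linearZ) /= lv lx1 -lamE x1v mulr1 mulr0 subr0.
move/eqP; rewrite subr_eq0 => /eqP E.
by move: hR; rewrite -E scale1r opprD addrA.
Qed.

Lemma abelian_rad_forms x y : om x y = 1 -> ideal_form L \/ P1_form L.
Proof.
move=> xy; have RR := abelian_rad_br xy.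
have [{x y xy} x [v [xv lx lv xvR]]] := abelian_rad_frame xy.
have RM := rad_mem Ll lamE RP xv.
have nullR : null_on R by move=> h k hR kR; rewrite RR // rl.
have lbr u h : h \in R -> lam (br u h) = 0 by move=> hR; rewrite -lamE rr.
have omv u : om u v = lam u.
  have := lamR (rad_mod Ll lamE RP xv u).
  by rewrite !(linearB, linearZ) /= lx lv mulr1 mulr0 subr0 => /eqP; rewrite subr_eq0 => /eqP.
have vR h : h \in R -> br v h \in R.
  move=> hR; apply: RM; first by rewrite omv lbr.
  by have := rad_trace Ll lamE RP xv hR; rewrite omv lbr // add0r lamR // oppr0.
(* The v-component of [x, h] modulo R. As v preserves R, the space R is an ideal exactly when p
   vanishes on it. *)
pose p h := om x (br x h).
have xR h : h \in R -> br x h - p h *: v \in R.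
  move=> hR; apply: RM; first by rewrite omv linearB linearZ /= lv lbr // mulr0 subr0.
  by rewrite (omDr Ll) (omNr Ll) (omZr Ll) xv mulr1 subrr.
have xE h : h \in R -> exists2 fh, fh \in R & br x h = fh + p h *: v.
  by move=> hR; exists (br x h - p h *: v); rewrite ?subrK ?xR.
have pD h k : p (h + k) = p h + p k by rewrite /p (brDr Ll) (omDr Ll).
have pZ c h : p (c *: h) = c * p h by rewrite /p (brZr Ll) (omZr Ll).
have [x0 v0 Hdir Hsum] := rad_dsum2 Ll lamE RP xv.
have [r rR xvE] : exists2 r, r \in R & br x v = x + r.
  by exists (br x v - x) => //; rewrite addrC subrK.
have jac h : h \in R -> br x h - br x (br v h) + br v (br x h) = h.
  move=> hR; have := omega_jacobi Ll x v h.
  rewrite xvE (brDl Ll) (RR r h) // addr0 xv scale1r (rl _ hR) (rr _ hR) !scale0r !addr0.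
  by rewrite (brC Ll _ x) (brC Ll _ v) (brC Ll h x) (brNr Ll) opprK.
have jac2 h k : h \in R -> k \in R -> p h *: br v k = p k *: br v h.
  move=> hR kR; have := omega_jacobi Ll x h k.
  rewrite (RR h k) // (br0l Ll) addr0 !(rl _ hR, rl _ kR, rr _ hR, rr _ kR) !scale0r !addr0.
  have [fh fhR ->] := xE h hR; rewrite (brC Ll k x); have [fk fkR ->] := xE k kR.
  rewrite (brNl Ll) !(brDl Ll) !(brZl Ll) (RR fh) // (RR fk) //.
  by rewrite !add0r => /eqP; rewrite subr_eq0 => /eqP.
have pvh h : h \in R -> p (br v h) = p h.
  move=> hR; have := congr1 (om x) (jac h hR).
  rewrite !(omDr Ll, omNr Ll) (rr _ hR) -/(p _) -/(p _).
  have [fh fhR ->] := xE h hR; rewrite (brDr Ll) (brZr Ll) (brxx Ll) scaler0 addr0.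
  by rewrite (rr _ (vR _ fhR)) addr0 => /eqP; rewrite subr_eq0 => /eqP.
have linp : linear (p : L -> F^o) by move=> c h k; rewrite pD pZ.
pose f : {linear L -> F^o} := HB.pack (p : L -> F^o) (GRing.isLinear.Build _ _ _ _ _ linp).
have [Rp|] := boolP (R <= lker (linfun f))%VS.
  left; exists R, x, v; split=> //.
    by split=> // h hR; rewrite rr.
  split=> // h hR.
  have := xR h hR; move/subvP/(_ h hR): Rp; rewrite memv_ker lfunE /= => /eqP ->.
  by rewrite scale0r subr0.
move/subvPn => [k kR]; rewrite memv_ker lfunE /= => pk; right.
(* By [jac2] the action of v on R is h -> p(h) g, and [pvh] gives p(g) = 1. *)
pose g := (p k)^-1 *: br v k.
have gR : g \in R by rewrite memvZ // vR.
have pg : p g = 1 by rewrite pZ pvh // mulVf.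
have vE h : h \in R -> br v h = p h *: g.
  by move=> hR; rewrite /g scalerA mulrC -scalerA (jac2 h k) // scalerA mulVf // scale1r.
clearbody g; clear k kR pk.
pose H1 := (R :&: lker (linfun f))%VS.
have H1P h : h \in H1 -> h \in R /\ p h = 0.
  by rewrite memv_cap memv_ker lfunE /= => /andP[-> /eqP].
have H1I h : h \in R -> p h = 0 -> h \in H1.
  by move=> hR ph; rewrite memv_cap hR memv_ker lfunE /= ph eqxx.
(* For h in the kernel of p, [jac] reads [x, h] + p([x, h]) g = h, and applying p gives 2 p([x, h])
   = 0. *)
have xH1 h : h \in H1 -> br x h = h.
  move=> /H1P[hR ph]; have xhR : br x h \in R by have := xR h hR; rewrite ph scale0r subr0.
  have := jac h hR; rewrite (vE h) // ph scale0r (br0r Ll) subr0 vE // => E.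
  have := congr1 p E; rewrite pD pZ pg mulr1 ph => /eqP.
  rewrite -mulr2n -mulr_natl mulf_eq0 pnatr_eq0 /= => /eqP pxh.
  by rewrite -[RHS]E pxh scale0r addr0.
(* [jac] at g reduces to [v, [x, g]] = g, that is (p(w) + 1) g = g, so p(w) = 0. *)
pose w := br x g - p g *: v - g.
have wH : w \in H1.
  apply: H1I; first by rewrite memvB ?xR.
  have := jac g gR; rewrite (vE g) // pg scale1r subrr add0r.
  have E : br x g = w + g + v by rewrite /w pg scale1r !subrK.
  have wR : w + g \in R by rewrite memvD // memvB // xR.
  rewrite E (brDr Ll) (brxx Ll) addr0 vE // pD pg scalerDl scale1r => /eqP.
  rewrite -subr_eq0 addrK scaler_eq0 => /orP[/eqP //|/eqP g0].
  by move: pg; rewrite g0 /p (br0r Ll) (om0r Ll) => /eqP; rewrite eq_sym oner_eq0.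
have xg : br x g = w + g + v by rewrite /w pg scale1r !subrK.
clearbody w.
have Rsum : (<[- g]> + H1)%VS = R.
  apply/eqP; rewrite eqEsubv; apply/andP; split; apply/subvP => h.
    move=> /memv_addP[_ /vlineP[c ->] [h' /H1P[h'R _] ->]].
    by rewrite memvD // memvZ // memvN.
  move=> hR; rewrite (_ : h = (- p h) *: (- g) + (h - p h *: g)); last first.
    by by_functionals; ring.
  rewrite memv_add ?memvZ ?memv_line //; apply: H1I; first by rewrite memvB // memvZ.
  by rewrite -scaleNr pD pZ pg mulr1 subrr.
have gH : - g \notin H1.
  by apply/negP => /H1P[_]; rewrite -scaleN1r pZ pg mulr1 => /eqP; rewrite oppr_eq0 oner_eq0.
(* The pair (-v, x) takes the place of (x, v) in [P1_form]: v kills H1, while x acts on H1 as the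
   identity. *)
have vx : om (- v) x = 1 by rewrite (omNl Ll) (omC Ll) opprK.
have [vR' xR'] := rad_notin Ll RP vx.
exists H1, (- g), (- v), x, r, (- w); split.
- split=> //; rewrite ?oppr_eq0 //.
  + by apply: contraNneq gH => ->; rewrite oppr0 mem0v.
  + by apply: directv_lineH2; rewrite ?Rsum.
  + by rewrite Rsum (rad_sum Ll lamE RP vx).
- by rewrite Rsum memvN.
- split.
  + by rewrite !(brE Ll) vE // pg scale1r opprK.
  + by move=> h hH; rewrite xH1.
  + by rewrite (brNr Ll) xg; by_functionals; ring.
  + by rewrite (brNl Ll) (brC Ll) opprK xvE addrC.
  + by [].
- rewrite Rsum; split=> // h hR; rewrite ?rr //.
  by have [hR' ph] := H1P h hR; rewrite (brNl Ll) vE // ph scale0r oppr0.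
Qed.
End AbelianRadical.

(** * The case where [lam] does not vanish on the radical *)

Section XyaForms.
Variables (F : fieldType) (L : omegaAlg F).

(** The clause on [b2] says that u -> [u, a] is diagonal modulo H unless b1 = c1 = -1/2; the
    remaining Jordan block accounts for [algB] and [algBt]. *)
Definition P2_form : Prop :=
  exists (H : {vspace L}) (x y a h1 h2 h3 : L) (b1 b2 c1 : F),
    [/\ xya_frame H x y a,
        [/\ h1 \in H, h2 \in H & h3 \in H],
        [/\ b1 != 0, c1 != 0, b1 + c1 + 1 = 0 & b1 != c1 -> b2 = 0],
        [/\ br x y = h3 + a,
            br x a = h1 + b1 *: x + b2 *: y
          & br y a = h2 + c1 *: y]
      & br_null x H /\ br_null y H].

(** The last relation is the H-component of the Jacobi identity on x, y, a. When H is a line it says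
    that h1 = 0 or y acts on H as - d1, which separates [algL2_1] and [algL2_3] from [algL1_8]. *)
Definition NP2_form : Prop :=
  exists (H : {vspace L}) (x y a h1 h2 h3 : L) (d1 : F),
    [/\ xya_frame H x y a,
        [/\ h1 \in H, h2 \in H & h3 \in H],
        br_null x H, {in H, forall h, br y h \in H}
      & [/\ br y a = h2, br x y = h3 + d1 *: x + a, br x a = h1 - x
          & d1 *: h1 + br y h1 = 0]].

(** om(x, [x, h]) is the y-coordinate of [x, h], the value at h of the functional [lambda] of
    [NP4_type]. *)
Definition NP4_form : Prop :=
  exists (H : {vspace L}) (x y a h3 h4 : L) (d1 : F),
    [/\ xya_frame H x y a, h3 \in H /\ h4 \in H,
        [/\ {in H, forall h, br x h - om x (br x h) *: y \in H},
            exists2 h, h \in H & om x (br x h) != 0 & br_null y H]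
      & [/\ br y a = - y, br x a = h4 & br x y = d1 *: y + a + h3]].

End XyaForms.

Section NonabelianRadical.
Variables (F : numClosedFieldType) (L : omegaAlg F).
Hypothesis Ll : omega_lie L.
Variable lam : {scalar L}.
Hypothesis lamE : forall u v : L, om u v = lam (br u v).
Implicit Types (u v w x y z h a : L) (c : F).
Variable R : {vspace L}.
Hypothesis RP : forall h, h \in R <-> forall u, om h u = 0.
Variable a : L.
Hypotheses (aR : a \in R) (lam_a : lam a = 1).

Let rl := rad_oml RP.
Let rr := rad_omr Ll RP.
Let lamf : {linear L -> F^o} := lam.
Let H := (R :&: lker (linfun lamf))%VS.

Lemma in_H h : (h \in H) = (h \in R) && (lam h == 0).
Proof. by rewrite memv_cap memv_ker lfunE. Qed.

(** Once [lam] kills x and y, the coordinates of u along x, y, a are om(u, y), om(x, u), lam(u); by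
    [lam_br_rad], brackets with R have no a-component. *)
Definition adapted x y := [/\ om x y = 1, lam x = 0 & lam y = 0].

Lemma lam_br_rad u h : h \in R -> lam (br u h) = 0.
Proof. by move=> hR; rewrite -lamE rr. Qed.

Lemma exists_adapted x y : om x y = 1 -> exists x' y', adapted x' y'.
Proof.
move=> xy; exists (x - lam x *: a), (y - lam y *: a); split.
- by rewrite !(omE Ll) xy (rr _ aR) !(rl _ aR); ring.
- by rewrite linearB linearZ /= lam_a mulr1 subrr.
- by rewrite linearB linearZ /= lam_a mulr1 subrr.
Qed.

Lemma adapted_decomp x y u : adapted x y ->
  exists2 h, h \in H & u = om u y *: x + om x u *: y + lam u *: a + h.
Proof.
case=> xy lx ly; exists (u - om u y *: x - om x u *: y - lam u *: a); last first.
  by by_functionals; ring.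
rewrite in_H memvB ?memvZ //; last exact: rad_mod xy _.
by rewrite !(linearB, linearZ) /= lx ly lam_a !mulr0 !subr0 mulr1 subrr.
Qed.

Lemma brH x y : adapted x y -> {in H &, forall h k, br h k = 0}.
Proof.
move=> [xy _ _] h k; rewrite !in_H => /andP[hR /eqP h0] /andP[kR /eqP k0].
by rewrite (br_rad Ll lamE RP xy) // h0 k0 !scale0r subr0.
Qed.

Lemma br_aH x y : adapted x y -> {in H, forall h, br a h = h}.
Proof.
move=> [xy _ _] h; rewrite in_H => /andP[hR /eqP h0].
by rewrite (br_rad Ll lamE RP xy) // h0 lam_a scale0r scale1r subr0.
Qed.

Lemma adapted_frame x y : adapted x y -> xya_frame H x y a.
Proof.
move=> gxy; have [xy lx ly] := gxy.
have HR h : h \in H -> h \in R by rewrite in_H => /andP[].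
have [xR yR] := rad_notin Ll RP xy.
have xH : x \notin H by apply: contra xR => /HR.
have yH : y \notin (H + <[x]>)%VS.
  apply: contra yR; apply/subvP/addvS => //; exact: capvSl.
have aH : a \notin (H + <[x]> + <[y]>)%VS.
  apply/negP => /memv_addP[_ /memv_addP[h + [_ /vlineP[k ->] ->]] [_ /vlineP[l ->]]].
  rewrite in_H => /andP[_ /eqP h0] /(congr1 lam).
  rewrite lam_a !(linearD, linearZ) /= h0 lx ly !mulr0 !addr0 => /eqP.
  by rewrite oner_eq0.
split=> //.
- split.
  + by apply: contraNneq xH => ->; rewrite mem0v.
  + by apply: contraNneq yH => ->; rewrite mem0v.
  + by apply: contraNneq aH => ->; rewrite mem0v.
  + exact: directv_line3.
  + apply/eqP; rewrite eqEsubv subvf /=; apply/subvP => u _.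
    have [h hH ->] := adapted_decomp u gxy.
    rewrite [_ + h]addrC !addrA.
    by rewrite !memv_add // memvZ // memv_line.
- exact: br_aH gxy.
- by rewrite !(rr _ aR).
- split=> [h k hH kH|h hH|h hH|h hH]; rewrite ?(rr _ (HR _ hH)) //.
  by rewrite (brH gxy) // rl // HR.
Qed.

Lemma adapted_swap x y : adapted x y -> adapted y (- x).
Proof.
by case=> xy lx ly; split; rewrite ?linearN /= ?lx ?oppr0 // (omNr Ll) (omC Ll) opprK.
Qed.

Lemma adapted_shear x y c : adapted x y -> adapted (x + c *: y) y.
Proof.
case=> xy lx ly; split=> //; first by rewrite !(omE Ll) xy mulr0 addr0.
by rewrite linearD linearZ /= lx ly mulr0 addr0.
Qed.

Lemma adapted_br_a x y : adapted x y -> exists h1 h2 b b2 c c2, [/\ h1 \in H, h2 \in H,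
  br x a = h1 + b *: x + b2 *: y, br y a = h2 + c2 *: x + c *: y & b + c + 1 = 0].
Proof.
move=> gxy; have [xy lx ly] := gxy.
have [h1 h1H xa] := adapted_decomp (br x a) gxy.
have [h2 h2H ya] := adapted_decomp (br y a) gxy.
exists h1, h2, (om (br x a) y), (om x (br x a)), (om x (br y a)), (om (br y a) y).
split=> //.
- by rewrite {1}xa lam_br_rad // scale0r addr0; by_functionals; ring.
- by rewrite {1}ya lam_br_rad // scale0r addr0; by_functionals; ring.
by rewrite (rad_trace Ll lamE RP xy aR) lam_a addNr.
Qed.

Lemma br_a_om x y x' h (s t : F) : h \in H -> adapted x y ->
  br x' a = h + s *: x + t *: y -> om x (br x' a) = t /\ om (br x' a) y = s.
Proof.
rewrite in_H => /andP[hR _] [xy _ _] ->.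
by rewrite !(omE Ll) !(rl _ hR, rr _ hR) xy; split; ring.
Qed.

(* In the plane spanned by x and y, [y', a] is a multiple of y' modulo H when
   y' is isotropic for the quadratic form om([u, a], u). *)
Lemma exists_triangular x y : adapted x y ->
  exists x' y', adapted x' y' /\ om (br y' a) y' = 0.
Proof.
move=> gxy; have [xy lx ly] := gxy.
have [ya|ya] := eqVneq (om (br y a) y) 0; first by exists x, y.
pose B := om (br x a) y + om (br y a) x; set A := om (br y a) y in ya *.
pose C := om (br x a) x.
pose t := (- B + sqrtC (B ^+ 2 - 4 * A * C)) / (2 * A).
have gy : adapted (- y) (x + t *: y).
  split; first by rewrite !(omE Ll) (omC Ll y) xy; ring.
    by rewrite linearN /= ly oppr0.
  by rewrite linearD linearZ /= lx ly mulr0 addr0.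
exists (- y), (x + t *: y); split=> //.
rewrite !(brE Ll) !(omE Ll) -/A -/C.
have E : (2 * A * t + B) ^+ 2 = B ^+ 2 - 4 * A * C.
  rewrite -[RHS]sqrtCK /t; congr (_ ^+ 2); field.
  by [].
have A4 : 4 * A != 0 by rewrite mulf_neq0 // pnatr_eq0.
apply: (mulfI A4); rewrite mulr0.
rewrite /B in E.

apply: (eq_comb E); ring.
Qed.
(** In a triangular frame with distinct eigenvalues, x + s y with s = b2 / (b - c) is an eigenvector
    modulo H. If one eigenvalue is 0 the other is -1, and a swap of the frame puts -1 on the first
    vector. Equal eigenvalues are both nonzero because their sum is -1. *)
Lemma exists_frame x y : adapted x y -> exists x' y' h1 h2 b b2 c,
  [/\ adapted x' y', h1 \in H /\ h2 \in H,
    br x' a = h1 + b *: x' + b2 *: y', br y' a = h2 + c *: y'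
  & (b = -1 /\ c = 0 /\ b2 = 0) \/
    [/\ b != 0, c != 0, b + c + 1 = 0 & b != c -> b2 = 0]].
Proof.
move=> /exists_triangular[{x} x [{y} y [gxy ya0]]].
have [h1 [h2 [b [b2 [c [c2 [h1H h2H xa ya bc]]]]]]] := adapted_br_a gxy.
have [_ c20] := br_a_om h2H gxy ya; rewrite {}c20 in ya0; rewrite {}ya0 scale0r addr0 in ya.
have [ebc|nbc] := eqVneq b c.
  exists x, y, h1, h2, b, b2, c; split=> //; right; rewrite -ebc eqxx.
  have b0 : b != 0.
    by apply: contraPneq bc => b0; rewrite -ebc b0 !add0r; apply/eqP/oner_neq0.
  by split=> //; rewrite {2}ebc.
pose s := b2 / (b - c); set x1 := x + s *: y.
have gx1 : adapted x1 y := adapted_shear s gxy.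
have h1'H : h1 + s *: h2 \in H by rewrite memvD ?memvZ.
have x1a : br x1 a = h1 + s *: h2 + b *: x1.
  rewrite /x1 !(brE Ll) xa ya; by_functionals; rewrite /s; field.
  by rewrite subr_eq0.
move: (h1 + _) h1'H x1a => k1 k1H x1a; clearbody x1.
have [b0|b0] := eqVneq b 0.
  exists y, (- x1), h2, (- k1), (-1), 0, 0; split.
  - exact: adapted_swap.
  - by rewrite memvN.
  - have -> : -1 = c by apply/eqP; rewrite eq_sym -addr_eq0 -bc b0 add0r.
    by rewrite ya scale0r addr0.
  - by rewrite !(brE Ll) x1a b0 !scale0r !addr0.
  - by left.
exists x1, y, k1, h2, b, 0, c; split=> //; first by rewrite x1a scale0r addr0.
have [c0|c0] := eqVneq c 0; last by right.
left; split=> //; apply/eqP.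
by rewrite -addr_eq0 -bc c0 addr0.
Qed.

Lemma H_om h u : h \in H -> om h u = 0 /\ om u h = 0.
Proof. by rewrite in_H => /andP[hR _]; rewrite (rl _ hR) (rr _ hR). Qed.

(** The eigenvalue shift: [u, a] = s u implies [[u, h], a] = (s - 1) [u, h]. The right side of the
    Jacobi identity vanishes because a and h are radical. *)
Lemma H_jacobi_a x y u h : adapted x y -> h \in H ->
  br (br u a) h - br u h - br (br u h) a = 0.
Proof.
move=> gxy hH; have := omega_jacobi Ll u a h.
have [hl hr] := (fun w => (H_om w hH).1, fun w => (H_om w hH).2).
rewrite !(rl _ aR, rr _ aR, hl, hr) !scale0r !addr0 (br_aH gxy) // (brC Ll h u) (brNl Ll).
exact.
Qed.

(** Components along x and y of [H_jacobi_a] at x and y. Given b + c = -1, the factors c - 1 - b and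
    b - 1 - c equal 2 c and 2 b, so they are invertible when c, respectively b, is nonzero. *)
Lemma adapted_br_H x y h1 h2 b b2 c : adapted x y -> h1 \in H -> h2 \in H ->
  br x a = h1 + b *: x + b2 *: y -> br y a = h2 + c *: y -> b + c + 1 = 0 ->
  {in H, forall h,
    [/\ om (br y h) y * (c - 1 - b) = 0, om (br x h) y = om (br y h) y * b2
      & om x (br x h) * (b - 1 - c) = 2 * b2 * om (br x h) y]}.
Proof.
move=> gxy h1H h2H xa ya bc h hH; have [xy lx ly] := gxy.
have HR k : k \in H -> k \in R by rewrite in_H => /andP[].
have hR := HR _ hH.
have HH := brH gxy; have aH := br_aH gxy.
have l0 : lam h = 0 by move: hH; rewrite in_H => /andP[_ /eqP].
have tr := rad_trace Ll lamE RP xy hR; rewrite l0 oppr0 in tr.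
have [k1 k1H xh] := adapted_decomp (br x h) gxy.
have [k2 k2H yh] := adapted_decomp (br y h) gxy.
rewrite lam_br_rad // scale0r addr0 in xh; rewrite lam_br_rad // scale0r addr0 in yh.
move: tr xh yh; set P := om (br x h) y; set Q := om x (br x h); set r := om (br y h) y.
set P' := om x (br y h) => tr xh yh.
have {tr} EP' : P' = - P by apply: (eq_comb tr); ring.
have J u := H_jacobi_a u gxy hH.
have Ha k : k \in H -> br k a = - k by move=> kH; rewrite (brC Ll) aH.
have Jy := J y; have Jx := J x; move: Jy Jx.
rewrite xa ya xh yh !(brDl Ll, brZl Ll) xa ya xh yh (HH h1) // (HH h2) // !Ha // => Jy Jx.
have omHl k u : k \in H -> om k u = 0 by case/(H_om u).
have omHr k u : k \in H -> om u k = 0 by case/(H_om u).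
have oy1 := congr1 (fun w => om w y) Jy; have oy2 := congr1 (om x) Jy.
have ox2 := congr1 (om x) Jx.
move: oy1 oy2 ox2; rewrite /= !(omE Ll) xy ?(omHl h1) // ?(omHl h2) // ?(omHl k1) // ?(omHl k2) //.
rewrite ?(omHr h1) // ?(omHr h2) // ?(omHr k1) // ?(omHr k2) // EP' => oy1 oy2 ox2.
have eP : P = r * b2 by apply: (eq_comb oy2); ring.
split=> //; first by apply: (eq_comb oy1); ring.
by apply: (eq_comb ox2); ring.
Qed.
Lemma adapted_brxy x y : adapted x y ->
  exists h3 d1 d2, h3 \in H /\ br x y = h3 + d1 *: x + d2 *: y + a.
Proof.
move=> gxy; have [xy lx ly] := gxy.
have [h3 h3H E] := adapted_decomp (br x y) gxy.
exists h3, (om (br x y) y), (om x (br x y)); split=> //.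
by rewrite {1}E -(lamE x y) xy scale1r; by_functionals; ring.
Qed.

Lemma generic_P2_form x y h1 h2 b b2 c : adapted x y -> h1 \in H -> h2 \in H ->
  br x a = h1 + b *: x + b2 *: y -> br y a = h2 + c *: y ->
  [/\ b != 0, c != 0, b + c + 1 = 0 & b != c -> b2 = 0] -> P2_form L.
Proof.
move=> gxy h1H h2H xa ya [b0 c0 bc b2E]; have [xy lx ly] := gxy.
have HH := brH gxy; have aH := br_aH gxy.
have Ha k : k \in H -> br k a = - k by move=> kH; rewrite (brC Ll) aH.
have brM u h : u = x \/ u = y -> h \in H -> br u h \in H.
  move=> ueq hH; have [Er EP EQ] := adapted_br_H gxy h1H h2H xa ya bc hH.
  have Er0 : om (br y h) y = 0.
    apply: (mulIf c0); rewrite mul0r; move: Er => /eqP; rewrite mulf_eq0 => /orP[/eqP->|].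
      by rewrite mul0r.
    move=> /eqP E; have : (2 * c) = 0 by apply: (eq_comb (eqD E bc)); ring.
    by move/eqP; rewrite mulf_eq0 pnatr_eq0 (negPf c0).
  rewrite Er0 mul0r in EP; rewrite EP mulr0 in EQ.
  have EQ0 : om x (br x h) = 0.
    move: EQ => /eqP; rewrite mulf_eq0 => /orP[/eqP // | /eqP E].
    have : 2 * b = 0 by apply: (eq_comb (eqD E bc)); ring.
    by move/eqP; rewrite mulf_eq0 pnatr_eq0 (negPf b0).
  have hR : h \in R by move: hH; rewrite in_H => /andP[].
  have lh : lam h = 0 by move: hH; rewrite in_H => /andP[_ /eqP].
  have := rad_trace Ll lamE RP xy hR; rewrite EP add0r lh oppr0 => EP'.
  by rewrite in_H lam_br_rad // eqxx andbT; apply: (rad_mem Ll lamE RP xy); case: ueq => ->.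
have yH0 h : h \in H -> br y h = 0.
  move=> hH; have yhH : br y h \in H by apply: brM => //; right.
  have := H_jacobi_a y gxy hH; rewrite ya (brDl Ll) (brZl Ll) HH // Ha // add0r opprK subrK.
  by move/eqP; rewrite scaler_eq0 (negPf c0) => /eqP.
have xH0 h : h \in H -> br x h = 0.
  move=> hH; have xhH : br x h \in H by apply: brM => //; left.
  have := H_jacobi_a x gxy hH; rewrite xa !(brDl Ll) !(brZl Ll) HH // Ha // yH0 // scaler0.
  rewrite add0r addr0 opprK subrK.
  by move/eqP; rewrite scaler_eq0 (negPf b0) => /eqP.
have [h3 [d1 [d2 [h3H xyE]]]] := adapted_brxy gxy.
(* The Jacobi identity on x, y, a. As b + 1 = - c and c + 1 = - b are nonzero, its x- and
   y-components give d1 = 0 and then d2 = 0. *)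
have J : (d1 * (b + 1)) *: x + (d1 * b2 + d2 * (c + 1)) *: y + d1 *: h1 + d2 *: h2 = 0.
  have := omega_jacobi Ll x y a; rewrite !(rl _ aR, rr _ aR) !scale0r !addr0 xy scale1r.
  rewrite (brC Ll a x) ya xa {1}xyE !(brE Ll) (Ha h3) // (brC Ll h2 x) (xH0 h2) //.
  rewrite (brC Ll h1 y) (yH0 h1) //.
  rewrite (brC Ll y x) xyE xa ya => E; apply: functional_ext => phi.
  have := congr1 phi E; rewrite !(linear0, linearD, linearB, linearN, linearZ) /= => E'.
  apply: (eq_comb (eqD E' (eqM (phi a + phi h3 + d1 * phi x + d2 * phi y) bc))); ring.
have [d10 d20] : d1 = 0 /\ d2 = 0.
  have J1 := congr1 (fun w => om w y) J; have J2 := congr1 (om x) J.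
  move: J1 J2; rewrite /= !(omE Ll) xy.
  rewrite !((H_om _ h1H).1, (H_om _ h2H).1, (H_om _ h1H).2, (H_om _ h2H).2).
  move=> J1 J2; have d10 : d1 = 0.
    by apply: (mulfI c0); apply: (eq_comb (eqB (eqM d1 bc) J1)); ring.
  split=> //; apply: (mulfI b0); apply: (eq_comb (eqB (eqM d2 bc) J2)).
  by rewrite d10; ring.
rewrite d10 d20 !scale0r !addr0 in xyE.
by exists H, x, y, a, h1, h2, h3, b, b2, c; split=> //; exact: adapted_frame.
Qed.

(** The eigenvalues are -1 on x and 0 on y. Now [x, h] lies in H and has eigenvalue -2, so it is 0,
    whereas [y, h] has eigenvalue -1, shared by x and H. Its x-component is a linear form on H: zero
    gives NP2, nonzero gives NP4. *)
Lemma degenerate_form x y h1 h2 : adapted x y -> h1 \in H -> h2 \in H ->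
  br x a = h1 - x -> br y a = h2 -> NP2_form L \/ NP4_form L.
Proof.
move=> gxy h1H h2H xa ya; have [xy lx ly] := gxy.
have HH := brH gxy; have aH := br_aH gxy.
have Ha k : k \in H -> br k a = - k by move=> kH; rewrite (brC Ll) aH.
have xa' : br x a = h1 + (-1) *: x + 0 *: y by rewrite xa scaleN1r scale0r addr0.
have ya' : br y a = h2 + 0 *: y by rewrite ya scale0r addr0.
have bc : -1 + 0 + 1 = 0 :> F by rewrite addr0 addNr.
have trH h : h \in H -> om (br x h) y = 0 /\ om x (br x h) = 0.
  move=> hH; have [_ EP EQ] := adapted_br_H gxy h1H h2H xa' ya' bc hH.
  rewrite EP mulr0; split=> //; move: EQ; rewrite EP !mulr0.
  have -> : -1 - 1 - 0 = - 2 :> F by ring.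
  by move/eqP; rewrite mulf_eq0 oppr_eq0 pnatr_eq0 orbF => /eqP.
have HRl h : h \in H -> h \in R /\ lam h = 0.
  by rewrite in_H => /andP[-> /eqP].
have xH h : h \in H -> br x h \in H.
  move=> hH; have [hR _] := HRl h hH; have [E1 E2] := trH h hH.
  by rewrite in_H lam_br_rad // eqxx andbT; exact: (rad_mem Ll lamE RP xy).
have yH h : h \in H -> br y h - om (br y h) y *: x \in H.
  move=> hH; have [hR lh] := HRl h hH; have [E1 E2] := trH h hH.
  have := rad_trace Ll lamE RP xy hR; rewrite E1 add0r lh oppr0 => E.
  have lE : lam (br y h - om (br y h) y *: x) = 0.
    by rewrite linearB linearZ /= lx lam_br_rad // mulr0 subr0.
  rewrite in_H lE eqxx andbT.
  apply: (rad_mem Ll lamE RP xy); first by rewrite (omDl Ll) (omNl Ll) (omZl Ll) xy mulr1 subrr.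
  by rewrite (omDr Ll) (omNr Ll) (omZr Ll) (omxx Ll) E mulr0 subr0.
have xH0 h : h \in H -> br x h = 0.
  move=> hH; have := H_jacobi_a x gxy hH; rewrite xa (brDl Ll) (brNl Ll) HH // Ha ?xH // add0r.
  by rewrite opprK subrK => /eqP; rewrite oppr_eq0 => /eqP.
have [h3 [d1 [d2 [h3H xyE]]]] := adapted_brxy gxy.
have linr : linear (fun h => om (br y h) y : F^o).
  by move=> c h k; rewrite (brDr Ll) (brZr Ll) (omDl Ll) (omZl Ll).
pose f : {linear L -> F^o} := HB.pack (fun h => om (br y h) y : F^o)
  (GRing.isLinear.Build _ _ _ _ _ linr).
have [Hr|] := boolP (H <= lker (linfun f))%VS.
  have r0 h : h \in H -> om (br y h) y = 0.
    by move/(subvP Hr); rewrite memv_ker lfunE /= => /eqP.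
  have {}yH h : h \in H -> br y h \in H.
    by move=> hH; have := yH h hH; rewrite r0 // scale0r subr0.
  left; have J : d2 *: y + (d1 *: h1 + d2 *: h2 + br y h1) = 0.
    have := omega_jacobi Ll x y a; rewrite !(rl _ aR, rr _ aR) !scale0r !addr0 xy scale1r.
    rewrite (brC Ll a x) ya xa {1}xyE !(brE Ll) (Ha h3) // (brC Ll h2 x) (xH0 h2) // (brC Ll h1 y).
    rewrite xyE xa ya => E; apply: functional_ext => phi.
    have := congr1 phi E; rewrite !(linear0, linearD, linearB, linearN, linearZ) /= => E'.
    by apply: (eq_comb E'); ring.
  have d20 : d2 = 0.
    have := congr1 (om x) J; rewrite /= !(omE Ll) xy.
    by rewrite (H_om _ h1H).2 (H_om _ h2H).2 (H_om _ (yH _ h1H)).2 !mulr0 !addr0 mulr1.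
  rewrite d20 !scale0r addr0 add0r in J; rewrite d20 scale0r addr0 in xyE.
  by exists H, x, y, a, h1, h2, h3, d1; split=> //; exact: adapted_frame.
move/subvPn => [k kH]; rewrite memv_ker lfunE /= => rk; right.
have omr h : om y (br y h) = - om (br y h) y by rewrite (omC Ll).
have yk : br y k - om (br y k) y *: x \in H := yH k kH.
pose k2 := br y k - om (br y k) y *: x.
have ykE : br y k = om (br y k) y *: x + k2 by rewrite /k2 addrC subrK.
have {k2 yk ykE} [r [k2 [r0 k2H ykE]]] : exists r k2, [/\ r != 0, k2 \in H & br y k = r *: x + k2].
  by exists (om (br y k) y), k2.
have h10 : h1 = 0.
  have := H_jacobi_a y gxy kH; rewrite ya HH // ykE (brDl Ll) (brZl Ll) xa Ha // => E.
  have : r *: h1 = 0.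
    apply: functional_ext => phi; have := congr1 phi E.
    rewrite !(linear0, linearD, linearB, linearN, linearZ) /= => E'.
    by apply: (eq_comb (esym E')); ring.
  by move/eqP; rewrite scaler_eq0 (negPf r0) => /eqP.
have d20 : d2 = 0.
  have := omega_jacobi Ll x y k.
  rewrite xy !((H_om _ kH).1, (H_om _ kH).2) scale1r !scale0r !addr0.
  rewrite xyE (brC Ll k x) xH0 // oppr0 (br0l Ll) ykE !(brDl Ll) !(brZl Ll) (brxx Ll).
  rewrite (HH h3) // xH0 // aH // (brC Ll k2) xH0 // ykE => E.
  have := congr1 (fun w => om w y) E; rewrite /= !(omE Ll) xy.
  rewrite !((H_om _ kH).1, (H_om _ k2H).1) => E'.
  apply: (mulfI r0); rewrite mulr0; apply: (eq_comb E'). ring.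
rewrite d20 scale0r addr0 in xyE; rewrite h10 add0r in xa.
(* In [NP4_form] it is the first vector that moves H out of itself, hence the frame (y, -x); the
   coordinate d1 along x becomes - d1 along -x. *)
exists H, y, (- x), a, h3, h2, (- d1); split.
- exact/adapted_frame/adapted_swap.
- by [].
- split.
  + by move=> h hH; rewrite omr scaleNr scalerN opprK; exact: yH.
  + by exists k => //; rewrite omr oppr_eq0.
  + by move=> h hH; rewrite (brNl Ll) xH0 // oppr0.
- split.
  + by rewrite (brNl Ll) xa.
  + by [].
  + by rewrite (brNr Ll) (brC Ll) opprK xyE; by_functionals; ring.
Qed.

Lemma nonabelian_rad_forms x y : om x y = 1 -> [\/ P2_form L, NP2_form L | NP4_form L].
Proof.
move=> /exists_adapted[{x} x [{y} y gxy]].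
have [{x y gxy} x [y [h1 [h2 [b [b2 [c [gxy [h1H h2H] xa ya]]]]]]]] := exists_frame gxy.
case=> [[b1 [c0 b20]]|bc].
  rewrite b1 b20 scaleN1r scale0r addr0 in xa; rewrite c0 scale0r addr0 in ya.
  by case: (degenerate_form gxy h1H h2H xa ya) => ?; [constructor 2 | constructor 3].
by constructor 1; exact: generic_P2_form gxy h1H h2H xa ya bc.
Qed.

End NonabelianRadical.

Section Forms.
Variables (F : numClosedFieldType) (L : omegaAlg F).
Hypothesis Ll : omega_lie L.

Lemma normal_forms : nontrivial L -> (2 < \dim {:L})%N ->
  [\/ ideal_form L, P1_form L | [\/ P2_form L, NP2_form L | NP4_form L]].
Proof.
move=> Lnt dimL; have [lam lamE] := om_exact Ll dimL.
have [R [x [y [xy RP]]]] := exists_radical Ll lamE Lnt.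
have [Rl|] := boolP (R <= lker (linfun (lam : {linear L -> F^o})))%VS.
  have lamR : {in R, forall h, lam h = 0}.
    by move=> h /(subvP Rl); rewrite memv_ker lfunE => /eqP.
  by case: (abelian_rad_forms Ll lamE RP lamR xy) => ?; [constructor 1 | constructor 2].
move/subvPn => [k kR]; rewrite memv_ker lfunE /= => lk.
constructor 3; apply: (nonabelian_rad_forms Ll lamE RP (a := (lam k)^-1 *: k)) xy.
  by rewrite memvZ.
by rewrite linearZ /= mulVf.
Qed.

End Forms.

(** * Simultaneous triangularization of a pair with [N, g] = N *)

Section Flags.
Variable F : numClosedFieldType.

(** Cayley-Hamilton with the characteristic polynomial split into linear factors, applied one factor
    at a time so that a vector can be followed modulo a subspace. *)
Lemma mx_split_annihilator n (M : 'M[F]_n) : exists cs : seq F,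
  forall v : 'rV_n, foldl (fun w c => w *m M - c *: w) v cs = 0.
Proof.
case: n M => [|n] M; first by exists [::] => v; rewrite [LHS]thinmx0.
have [cs csE] := closed_field_poly_normal (char_poly M).
rewrite (monicP (char_poly_monic M)) scale1r in csE.
exists cs => v; have := Cayley_Hamilton M; rewrite csE rmorph_prod /= => E.
rewrite -[RHS](mulmx0 _ v) -[X in v *m X]E.
elim: cs {csE E} v => [|c cs IH] v; first by rewrite big_nil mulmx1.
rewrite /= IH big_cons -[_ * _]/(_ *m _) mulmxA; congr (_ *m _).
by rewrite rmorphB /= horner_mx_X horner_mx_C mulmxBr mul_mx_scalar.
Qed.

Variables (V : vectType F) (N g : 'End(V)).

Lemma split_annihilator : exists cs : seq F,
  forall u : V, foldl (fun w c => g w - c *: w) u cs = 0.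
Proof.
have [cs csP] := mx_split_annihilator (f2mx g); exists cs => u.
have gE w : v2r (g w) = v2r w *m f2mx g by rewrite unlock /= r2vK.
apply: v2r_inj; rewrite linear0 -[RHS](csP (v2r u)).
by elim: cs {csP} u => [//|c cs IH] u /=; rewrite IH linearB linearZ /= gE.
Qed.

Hypothesis Ng : forall u, N (g u) - g (N u) = N u.
Variable W : {vspace V}.
Hypotheses (NW : {in W, forall u, N u \in W}) (gW : {in W, forall u, g u \in W}).

(* If [w] is an eigenvector of [g] modulo [W] with eigenvalue [c], then so is
   [N w] with eigenvalue [c - 1], unless [N w] lies in [W]. *)
Lemma common_eigenvector : W != fullv -> exists w c,
  [/\ w \notin W, N w \in W & g w - c *: w \in W].
Proof.
move=> WV; have [cs csP] := split_annihilator.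
have [u _ uW] : exists2 u, u \in fullv & u \notin W.
  by apply/subvPn; apply: contra WV => VW; rewrite eqEsubv subvf.
(* Modulo W the factor for d multiplies w by c - d; since the whole product kills w, which is not in
   W, some d equals c. *)
have in_cs w c : w \notin W -> g w - c *: w \in W -> c \in cs.
  move=> wW gw; have [k [v [vW E]]] : exists (k : F) v, [/\ v \in W,
      foldl (fun w c => g w - c *: w) w cs = k *: w + v & (k != 0) || (c \in cs)].
    suff: forall k v, v \in W -> exists (k' : F) v', [/\ v' \in W,
      foldl (fun w c => g w - c *: w) (k *: w + v) cs = k' *: w + v'
      & (k' == 0) ==> (k == 0) || (c \in cs)].
      move=> /(_ 1 0 (mem0v _))[k [v [vW E kP]]]; exists k, v; rewrite scale1r addr0 in E.
      by split=> //; move: kP; rewrite oner_eq0; case: eqP.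
    elim: cs {csP} => [|d cs IH] k v vW /=; first by exists k, v; rewrite orbF implybb.
    have vW' : k *: (g w - c *: w) + (g v - d *: v) \in W.
      by rewrite memvD ?memvZ // memvB ?memvZ ?gW.
    have [k' [v' [v'W E kP]]] := IH (k * (c - d)) _ vW'.
    exists k', v'; split=> //.
      rewrite -E; congr (foldl _ _ cs); rewrite linearD linearZ /=.
      by by_functionals; ring.
    apply/implyP => /(implyP kP); rewrite mulf_eq0 subr_eq0 in_cons.
    by move=> /orP[/orP[->//|->]|->]; rewrite ?orbT.
  case/orP=> // k0; case/negP: wW; rewrite -[w]scale1r -(mulVf k0) -scalerA memvZ //.
  by rewrite (_ : k *: w = - v) ?memvN //; apply/eqP; rewrite -addr_eq0 -E csP.
have [w [c [wW gw]]] : exists w c, w \notin W /\ g w - c *: w \in W.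
  have := csP u; move: {csP in_cs} cs u uW.
  elim=> [|c cs IH] u uW /=; first by move=> u0; rewrite u0 mem0v in uW.
  have [gu _|gu] := boolP (g u - c *: u \in W); [by exists u, c | exact: IH].
pose good := exists w c, [/\ w \notin W, N w \in W & g w - c *: w \in W].
have step m : good \/ (exists2 w, w \notin W & g w - (c - m%:R) *: w \in W) /\
    (forall k, (k <= m)%N -> c - k%:R \in cs).
  elim: m => [|m [|[[v vW gv] IH]]]; [|by left|].
    right; split; first by exists w; rewrite // subr0.
    by move=> k; rewrite leqn0 => /eqP->; rewrite subr0; exact: in_cs gw.
  have [Nv|Nv] := boolP (N v \in W); first by left; exists v, (c - m%:R).
  have gNv : g (N v) - (c - m.+1%:R) *: N v \in W.
    have E : g (N v) = N (g v) - N v by rewrite -{2}Ng opprB addrC subrK.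
    have -> : g (N v) - (c - m.+1%:R) *: N v = N (g v - (c - m%:R) *: v).
      rewrite E linearB linearZ /= -natr1; by_functionals; ring.
    exact: NW.
  right; split; first by exists (N v).
  by move=> k; rewrite leq_eqVlt => /orP[/eqP->|]; [exact: in_cs gNv | exact: IH].
(* Otherwise c, c - 1, ..., c - size cs, distinct in characteristic 0, would be [size cs + 1]
   elements of [cs]. *)
have [//|[_ all_cs]] := step (size cs).
pose sh (k : nat) := c - k%:R; have : (size (mkseq sh (size cs).+1) <= size cs)%N.
  apply: uniq_leq_size.
    by rewrite mkseq_uniq // => i j /addrI/oppr_inj/eqP; rewrite eqr_nat => /eqP.
  by move=> z /mapP[k]; rewrite mem_iota add0n => /= k_lt ->; apply: all_cs.
by rewrite size_mkseq ltnn.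
Qed.

End Flags.

Section FlagBasis.
Variables (F : numClosedFieldType) (V : vectType F) (N g : 'End(V)).
Hypothesis Ng : forall u, N (g u) - g (N u) = N u.

Lemma flag_basis n : \dim {:V} = n -> exists b : n.-tuple V, basis_of fullv b /\
  forall j, (j < n)%N ->
    N b`_j \in <<take j b>>%VS /\ g b`_j \in <<take j.+1 b>>%VS.
Proof.
move=> <-; suff ext m : (m <= \dim {:V})%N -> exists s : seq V, [/\ size s = m, free s &
    forall j, (j < m)%N -> N s`_j \in <<take j s>>%VS /\ g s`_j \in <<take j.+1 s>>%VS].
  have [s [sz fs Hs]] := ext _ (leqnn _).
  have szb : size s == \dim {:V} by rewrite sz.
  by exists (Tuple szb); split; rewrite // basisEfree fs subvf /= sz.
elim: m => [|m IH] ltm; first by exists [::]; rewrite nil_free.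
have [s [sz fs Hs]] := IH (ltnW ltm).
have mono j u : u \in <<take j s>>%VS -> u \in <<s>>%VS.
  by apply/subvP/sub_span => v; exact: mem_take.
have NW : {in <<s>>%VS, forall u, N u \in <<s>>%VS}.
  move=> u; rewrite -(in_tupleE s) => /coord_span ->; rewrite linear_sum memv_suml // => i _.
  rewrite linearZ memvZ //; have /Hs[Ni _] : (i < m)%N by rewrite -sz ltn_ord.
  exact: mono Ni.
have gW : {in <<s>>%VS, forall u, g u \in <<s>>%VS}.
  move=> u; rewrite -(in_tupleE s) => /coord_span ->; rewrite linear_sum memv_suml // => i _.
  rewrite linearZ memvZ //; have /Hs[_ gi] : (i < m)%N by rewrite -sz ltn_ord.
  exact: mono gi.
have sV : <<s>>%VS != fullv.
  apply: contraTneq ltm => sV; rewrite -leqNgt -sV -sz; exact: dim_span.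
have [w [c [ws Nw gw]]] := common_eigenvector Ng NW gW sV.
exists (rcons s w); split.
- by rewrite size_rcons sz.
- have : perm_eq (rcons s w) (w :: s) by rewrite perm_rcons.
  by move/perm_free => ->; rewrite free_cons ws.
move=> j; rewrite ltnS leq_eqVlt => /orP[/eqP->|jm].
  rewrite -sz nth_rcons ltnn eqxx; split.
    by rewrite -cats1 take_size_cat.
  rewrite -(size_rcons s w) take_size -(subrK (c *: w) (g w)) memvD //.
    by move: gw; apply/subvP/sub_span => v vs; rewrite mem_rcons in_cons vs orbT.
  by rewrite memvZ // memv_span // mem_rcons mem_head.
rewrite nth_rcons sz jm -cats1 !takel_cat ?sz ?(ltnW jm) //; exact: Hs.
Qed.

End FlagBasis.

(** * Matrices in a flag basis and passage to the types *)

Section Coordinates.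
Variables (F : fieldType) (V : vectType F) (n : nat) (b : n.-tuple V).

Lemma coord_take_eq0 (i : 'I_n) j u :
  free b -> (j <= i)%N -> u \in <<take j b>>%VS -> coord b i u = 0.
Proof.
move=> fb ji; rewrite -(in_tupleE (take j b)) => /coord_span ->.
rewrite linear_sum big1 // => k _; rewrite linearZ /=.
have /andP[kj kn] : (k < j)%N && (k < n)%N.
  by rewrite -ltn_min -[X in minn j X](size_tuple b) -size_take_min ltn_ord.
rewrite nth_take // -[nat_of_ord k]/(nat_of_ord (Ordinal kn)) coord_free // -val_eqE /=.
by rewrite (ltn_eqF (leq_trans kj ji)) mulr0.
Qed.

Lemma mat_of_comp (f g : 'End(V)) : basis_of fullv b ->
  mat_of b (f \o g)%VF = mat_of b f *m mat_of b g.
Proof.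
move=> bb; apply/matrixP => i k; rewrite !mxE comp_lfunE.
rewrite {1}(coord_basis bb (memvf (g b`_k))) !linear_sum /=.
by apply: eq_bigr => j _; rewrite !mxE !linearZ /= mulrC.
Qed.

End Coordinates.

Section Types.
Variables (F : numClosedFieldType) (L : omegaAlg F).
Hypothesis Ll : omega_lie L.

Lemma restrict_end (H : {vspace L}) (T : L -> L) : linear T ->
  {in H, forall h, T h \in H} ->
  exists f : 'End(subvs_of H), forall h : subvs_of H, T (vsval h) = vsval (f h).
Proof.
move=> linT TH.
have linS : linear (fun h : subvs_of H => vsproj H (T (vsval h))).
  by move=> c h k; rewrite linearP /= linT linearP.
pose S : {linear subvs_of H -> subvs_of H} :=
  HB.pack (fun h : subvs_of H => vsproj H (T (vsval h))) (GRing.isLinear.Build _ _ _ _ _ linS).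
by exists (linfun S) => h; rewrite lfunE /= vsprojK // TH // subvsP.
Qed.

Lemma P2_form_type : P2_form L -> P2_type L.
Proof.
case=> H [x [y [a [h1 [h2 [h3 [b1 [b2 [c1 [fr hs [b0 c0 bc _] brs nulls]]]]]]]]]].
by exists H, x, y, a, h1, h2, h3, b1, b2, c1.
Qed.

Lemma NP2_form_type : NP2_form L -> NP2_type L.
Proof.
case=> H [x [y [a [h1 [h2 [h3 [d1 [fr hs xH yH [ya xy xa _]]]]]]]]].
have [g gE] := restrict_end (br_linearr Ll y) yH.
exists H, x, y, a, h1, h2, h3, 0, d1, 0, g; split=> //; split=> //.
- by move=> h; rewrite xH ?subvsP // zero_lfunE.
- by rewrite mul0r scale0r subr0.
- by rewrite scale0r addr0.
Qed.

Lemma NP4_form_type : NP4_form L -> NP4_type L.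
Proof.
case=> H [x [y [a [h3 [h4 [d1 [fr [h3H h4H] [xH [k kH pk] yH] [ya xa xy]]]]]]]].
pose T h : L := br x h - om x (br x h) *: y.
have linT : linear T.
  move=> c h k'; rewrite /T (brDr Ll) (brZr Ll) (omDr Ll) (omZr Ll).
  by by_functionals; ring.
have [f fE] := restrict_end linT xH.
have linp : linear (fun h : subvs_of H => om x (br x (vsval h)) : F^o).
  by move=> c h k'; rewrite linearP (brDr Ll) (brZr Ll) (omDr Ll) (omZr Ll).
pose p : {linear subvs_of H -> F^o} := HB.pack
  (fun h : subvs_of H => om x (br x (vsval h)) : F^o) (GRing.isLinear.Build _ _ _ _ _ linp).
exists H, x, y, a, h3, h4, 0, d1, (linfun p), f; split=> //.
- split=> //; apply/eqP => /lfunP/(_ (vsproj H k)).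
  by rewrite !lfunE /= vsprojK // => /eqP; rewrite (negPf pk).
- split=> //; last by rewrite scale0r add0r.
  by move=> h; rewrite -fE lfunE /= addrC subrK.
Qed.

(** The relation says f - 1 = [f, g], and the identity commutes with g. *)
Lemma ideal_form_commutator (H : {vspace L}) (x v : L) (f g : 'End(subvs_of H)) :
  (forall h : subvs_of H, br x (vsval h) = vsval (f h)) ->
  (forall h : subvs_of H, br v (vsval h) = vsval (g h)) ->
  {in H, forall h, br x h - br x (br v h) + br v (br x h) = h} ->
  forall h, (f - \1)%VF (g h) - g ((f - \1)%VF h) = (f - \1)%VF h.
Proof.
move=> fE gE rel h; apply: val_inj => /=; have := rel _ (subvsP h).
rewrite fE gE fE gE => E; rewrite !(add_lfunE, opp_lfunE, id_lfunE) linearB.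
apply: functional_ext => phi; have := congr1 phi E.
rewrite !(linearD, linearB) /= => E'.
by apply: (eq_comb (esym E')); ring.
Qed.

Lemma ideal_form_type : ideal_form L -> NP1_type L.
Proof.
case=> H [x [v [dsum omxv nulls xvH [xH vH rel]]]].
have [f fE] := restrict_end (br_linearr Ll x) xH.
have [g gE] := restrict_end (br_linearr Ll v) vH.
pose N := (f - \1)%VF.
have NE h : N h = f h - h by rewrite !(add_lfunE, opp_lfunE, id_lfunE).
have Ng := ideal_form_commutator fE gE rel; rewrite -/N in Ng.
have dimH : \dim {:subvs_of H} = \dim H by rewrite dimvf.
have [b [bb flag]] := flag_basis Ng dimH.
have fb := basis_free bb.
exists H, x, v, (br x v - x), f, g; split=> //; first by split=> //; rewrite subrK.
exists b, (mat_of b N); split=> //.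
- by apply/matrixP => i j; rewrite !mxE NE linearB /= coord_free // eq_sym addrC subrK.
- by rewrite -!mat_of_comp //; apply/matrixP => i j; rewrite !mxE -linearB /= !comp_lfunE Ng.
- move=> i j ji; rewrite mxE; apply: coord_take_eq0 ji _ => //.
  by case: (flag j (ltn_ord j)).
- move=> i j ji; rewrite mxE; apply: coord_take_eq0 ji _ => //.
  by case: (flag j (ltn_ord j)).
Qed.

End Types.

(** * Explicit changes of basis in dimensions 4 and 3 *)

Section SpanChange.
Variables (F : fieldType) (V : vectType F).

Fixpoint lin (cs : seq F) (s : seq V) : V :=
  match cs, s with
  | c :: cs', u :: s' => c *: u + lin cs' s'
  | _, _ => 0
  end.

Lemma lin_span cs s : lin cs s \in <<s>>%VS.
Proof.
elim: s cs => [|u s IH] [|c cs] /=; rewrite ?mem0v //.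
by rewrite span_cons memv_add // memvZ // memv_line.
Qed.

(** The rows of [M] express the old spanning list in the new one, so giving the inverse matrix
    replaces an independence proof. *)
Lemma span_change (M : seq (seq F)) (s t : seq V) :
  <<s>>%VS = fullv -> s = [seq lin cs t | cs <- M] -> <<t>>%VS = fullv.
Proof.
move=> sV E; apply/eqP; rewrite eqEsubv subvf -sV; apply/span_subvP => u.
by rewrite E => /mapP[cs _ ->]; exact: lin_span.
Qed.

End SpanChange.

Ltac by_lin := congr [:: _; _; _; _] + congr [:: _; _; _]; by_functionals.
(* Selects a disjunct counted from 0; [try] covers the last one, where no [left] remains. *)
Tactic Notation "pick" integer(n) := do n right; try left.

(* The families L_{1,3}, L_{1,4}, L_{1,6}, F, G and H of the list are not needed:
   they are isomorphic to other members of it. *)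
Section Dim4.
Variables (F : numClosedFieldType) (L : omegaAlg F).
Hypotheses (Ll : omega_lie L) (dimL : \dim {:L} = 4).
Implicit Types x y v z e a h : L.

Definition frame4 x y z e : Prop :=
  [/\ <<[:: x; y; z; e]>>%VS = fullv, om x y = 1,
      om x z = 0 /\ om x e = 0, om y z = 0 /\ om y e = 0 & om z e = 0].

Local Ltac br_simp x y z e :=
  rewrite ?(brE Ll) ?(brC Ll y x) ?(brC Ll z x) ?(brC Ll e x)
    ?(brC Ll z y) ?(brC Ll e y) ?(brC Ll e z).
Local Ltac om_simp x y z e :=
  rewrite ?(omE Ll) ?(omC Ll y x) ?(omC Ll z x) ?(omC Ll e x)
    ?(omC Ll z y) ?(omC Ll e y) ?(omC Ll e z).
Local Tactic Notation "base_change" uconstr(M) constr(sp) :=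
  refine (@span_change F L M _ _ sp _); by_lin; field.
Local Ltac check_table sp x y z e E :=
  apply: (table_iso_eval Ll _ dimL sp) => //;
  (let H := fresh in
  move=> [|[|[|[|?]]]] [|[|[|[|?]]]] H //=; rewrite ?combE /=;
  try (by case/andP: H); clear H);
  br_simp x y z e; om_simp x y z e; rewrite ?E; try by_functionals.

(** The triple (-v, x, z) spans a copy of [algL1]; what varies is the action of x and v on the plane
    spanned by z and e, with [s * (t - 1) = 0] as its commutation relation. For t nonzero, e is
    moved along z to an eigenvector of v. *)
Lemma ideal_dim4 x v z e (s q t : F) : frame4 x v z e ->
  br x v = x -> br x z = z -> br x e = e + s *: z -> br v z = 0 ->
  br v e = q *: z + t *: e -> br z e = 0 -> s * (t - 1) = 0 -> classified4 L.
Proof.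
case=> sp oxv [oxz oxe] [ovz ove] oze xv xz xe vz ve ze st.
have E := (xv, xz, xe, vz, ve, ze, oxv, (oxz, oxe, ovz, ove, oze)).
have [s0|s0] := eqVneq s 0; last first.
  have t1 : t = 1 by move/eqP: st; rewrite mulf_eq0 (negPf s0) subr_eq0 => /eqP.
  pick 6; rewrite {}t1 in ve E.
  have sp' : <<[:: - v; x; - s *: z; e + q *: z]%R>>%VS = fullv.
    by base_change [:: [:: 0; 1; 0; 0]; [:: -1; 0; 0; 0]; [:: 0; 0; - s^-1; 0];
                       [:: 0; 0; q / s; 1]] sp.
  by check_table sp' x v z e E; ring.
rewrite {}s0 scale0r addr0 in xe E => {st}.
have [t0|t0] := eqVneq t 0.
  rewrite {}t0 scale0r addr0 in ve E.
  have [q0|q0] := eqVneq q 0.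
    pick 0; rewrite {}q0 scale0r in ve E.
    have sp' : <<[:: - v; x; z; e]%R>>%VS = fullv.
      by base_change [:: [:: 0; 1; 0; 0]; [:: -1; 0; 0; 0]; [:: 0; 0; 1; 0];
                         [:: 0; 0; 0; 1]] sp.
    by check_table sp' x v z e E; ring.
  pick 1.
  have sp' : <<[:: - v; x; q *: z; e]%R>>%VS = fullv.
    by base_change [:: [:: 0; 1; 0; 0]; [:: -1; 0; 0; 0]; [:: 0; 0; q^-1; 0];
                       [:: 0; 0; 0; 1]] sp.
  by check_table sp' x v z e E; ring.
have sp' : <<[:: - v; x; z; e + (q / t) *: z]%R>>%VS = fullv.
  by base_change [:: [:: 0; 1; 0; 0]; [:: -1; 0; 0; 0]; [:: 0; 0; 1; 0];
                     [:: 0; 0; - (q / t); 1]] sp.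
have [t1|t1] := eqVneq t 1.
  by pick 4; check_table sp' x v z e E; rewrite ?t1; field.
by pick 12; exists t; split=> //; check_table sp' x v z e E; field.
Qed.

Lemma P1_dim4 x v h e (k r0 r1 : F) : frame4 x v h e ->
  br x v = r0 *: h + r1 *: e + v -> br x h = - h -> br x e = 0 ->
  br v h = k *: e + h + x -> br v e = e -> br h e = 0 -> classified4 L.
Proof.
case=> sp oxv [oxh oxe] [ovh ove] ohe xv xh xe vh ve he.
have E := (xv, xh, xe, vh, ve, he, oxv, (oxh, oxe, ovh, ove, ohe)).
pick 16; exists (- r0).
have sp' : <<[:: h; x + k *: e; - v + (k - r1) *: e; e]%R>>%VS = fullv.
  by base_change [:: [:: 0; 1; 0; - k]; [:: 0; 0; -1; k - r1]; [:: 1; 0; 0; 0];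
                     [:: 0; 0; 0; 1]] sp.
by check_table sp' x v h e E; ring.
Qed.

Lemma P2_dim4_core x y a h (b b2 c : F) : frame4 x y a h ->
  br x y = a -> br x a = b *: x + b2 *: y -> br x h = 0 -> br y a = c *: y ->
  br y h = 0 -> br a h = h ->
  [/\ b != 0, c != 0, b + c + 1 = 0 & b != c -> b2 = 0] -> classified4 L.
Proof.
case=> sp oxy [oxa oxh] [oya oyh] oah xy xa xh ya yh ah [b0 c0 bc b2P].
have E := (xy, xa, xh, ya, yh, ah, oxy, (oxa, oxh, oya, oyh, oah)).
have eb : b = - (1 + c) by apply: (eq_comb bc); ring.
have [b20|b20] := eqVneq b2 0.
  rewrite {}b20 scale0r addr0 in xa E.
  pick 18; exists (b / c); split.
  - by rewrite mulf_neq0 // invr_eq0.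
  - apply: contraPneq bc => bcN; suff -> : b = - c by rewrite addNr add0r; apply/eqP/oner_neq0.
    by rewrite -[b](mulfVK c0) bcN mulN1r.
  have sp' : <<[:: - c^-1 *: a; y; c^-1 *: x; h]%R>>%VS = fullv.
    by base_change [:: [:: 0; 0; c; 0]; [:: 0; 1; 0; 0]; [:: - c; 0; 0; 0];
                       [:: 0; 0; 0; 1]] sp.
  by check_table sp' x y a h E; rewrite ?eb; field.
have ebc : c = b by case: (eqVneq b c) b20 => // /b2P ->; rewrite eqxx.
have n2 : 2 != 0 :> F by rewrite pnatr_eq0.
have b_half : b = - 2^-1.
  by apply: (mulfI n2); apply: (eq_comb bc); rewrite ebc; field.
rewrite {}ebc {}b_half {eb bc b0 c0 b2P} in xa ya E.
(* Scaling x and y by the square root of b2 normalizes the Jordan block to that of [algBt]. *)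
have w0 : sqrtC b2 != 0 by rewrite sqrtC_eq0.
have b2E : b2 = sqrtC b2 ^+ 2 by rewrite sqrtCK.
move: {b20} (sqrtC b2) w0 b2E => w w0 b2E; rewrite {}b2E in xa E.
pick 17.
have sp' : <<[:: 2 *: a; - (2 * w) *: y; w^-1 *: x; h]%R>>%VS = fullv.
  by base_change [:: [:: 0; 0; w; 0]; [:: 0; - (2 * w)^-1; 0; 0]; [:: 2^-1; 0; 0; 0];
                     [:: 0; 0; 0; 1]] sp.
by check_table sp' x y a h E; field.
Qed.

Lemma P2_dim4 x y a h (m n k b b2 c : F) : frame4 x y a h ->
  br x y = k *: h + a -> br x a = m *: h + b *: x + b2 *: y -> br x h = 0 ->
  br y a = n *: h + c *: y -> br y h = 0 -> br a h = h ->
  [/\ b != 0, c != 0, b + c + 1 = 0 & b != c -> b2 = 0] -> classified4 L.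
Proof.
case=> sp oxy [oxa oxh] [oya oyh] oah xy xa xh ya yh ah bcP.
have E := (xy, xa, xh, ya, yh, ah, oxy, (oxa, oxh, oya, oyh, oah)).
have [b0 c0 bc _] := bcP; have eb : b = - (1 + c) by apply: (eq_comb bc); ring.
have nb : - (1 + c) != 0 by rewrite -eb.
have nb' : 1 + c != 0 by rewrite -oppr_eq0.
(* Chosen to cancel the h-terms of [y, a] and [x, a], using 1 + c = - b and 1 + b = - c. *)
pose t := - (n / b); pose s := (b2 * t - m) / c.
apply: (P2_dim4_core (x := x + s *: h) (y := y + t *: h) (a := a + k *: h) (h := h)) bcP.
- split; try split; om_simp x y a h; rewrite ?E; try ring.
  by base_change [:: [:: 1; 0; 0; - s]; [:: 0; 1; 0; - t]; [:: 0; 0; 1; - k];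
                     [:: 0; 0; 0; 1]] sp.
- by br_simp x y a h; rewrite ?E; by_functionals; ring.
- by br_simp x y a h; rewrite ?E; by_functionals; rewrite /s /t eb; field; rewrite ?nb ?nb' ?c0.
- by br_simp x y a h; rewrite ?E; by_functionals; ring.
- by br_simp x y a h; rewrite ?E; by_functionals; rewrite /t eb; field; rewrite ?nb ?nb' ?c0.
- by br_simp x y a h; rewrite ?E; by_functionals; ring.
- by br_simp x y a h; rewrite ?E; by_functionals; ring.
Qed.

Lemma NP2_dim4_core x y a h (m g : F) : frame4 x y a h ->
  br x y = a -> br x a = m *: h - x -> br x h = 0 -> br y a = 0 ->
  br y h = g *: h -> br a h = h -> g * m = 0 -> classified4 L.
Proof.
case=> sp oxy [oxa oxh] [oya oyh] oah xy xa xh ya yh ah gm.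
have E := (xy, xa, xh, ya, yh, ah, oxy, (oxa, oxh, oya, oyh, oah)).
have [m0|m0] := eqVneq m 0; last first.
  have g0 : g = 0 by move/eqP: gm; rewrite mulf_eq0 (negPf m0) orbF => /eqP.
  rewrite {}g0 scale0r in yh E.
  pick 7.
  have sp' : <<[:: x + y + m *: h; a - x; m *: h; x]%R>>%VS = fullv.
    by base_change [:: [:: 0; 0; 0; 1]; [:: 1; 0; -1; -1]; [:: 0; 1; 0; 1];
                       [:: 0; 0; m^-1; 0]] sp.
  by check_table sp' x y a h E; ring.
rewrite {}m0 scale0r add0r in xa E.
have [g0|g0] := eqVneq g 0.
  rewrite {}g0 scale0r in yh E.
  pick 8.
  have sp' : <<[:: - y; a; x; h]%R>>%VS = fullv.
    by base_change [:: [:: 0; 0; 1; 0]; [:: -1; 0; 0; 0]; [:: 0; 1; 0; 0];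
                       [:: 0; 0; 0; 1]] sp.
  by check_table sp' x y a h E; ring.
pick 10.
have sp' : <<[:: - g^-1 *: y; a; g *: x; h]%R>>%VS = fullv.
  by base_change [:: [:: 0; 0; g^-1; 0]; [:: - g; 0; 0; 0]; [:: 0; 1; 0; 0];
                     [:: 0; 0; 0; 1]] sp.
by check_table sp' x y a h E; field.
Qed.

Lemma NP2_dim4 x y a h (m n k d g : F) : frame4 x y a h ->
  br x y = k *: h + d *: x + a -> br x a = m *: h - x -> br x h = 0 -> br y a = n *: h ->
  br y h = g *: h -> br a h = h -> (d + g) * m = 0 -> classified4 L.
Proof.
case=> sp oxy [oxa oxh] [oya oyh] oah xy xa xh ya yh ah dgm.
have E := (xy, xa, xh, ya, yh, ah, oxy, (oxa, oxh, oya, oyh, oah)).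
(* Adding d a to y removes d x from [x, y]; then k' is absorbed into a, and l makes [y, a] vanish.
   The eigenvalue of y on h becomes g + d. *)
pose k' := k + d * m; pose l := n + k' * (g + d).
have dm : d * m = - (g * m) by apply: (eq_comb dgm); ring.
apply: (NP2_dim4_core (x := x) (y := y + d *: a + l *: h) (a := a + k' *: h) (h := h)
  (m := m) (g := g + d)).
- split; try split; om_simp x y a h; rewrite ?E; try ring.
  by base_change [:: [:: 1; 0; 0; 0]; [:: 0; 1; - d; d * k' - l]; [:: 0; 0; 1; - k'];
                     [:: 0; 0; 0; 1]] sp.
- by br_simp x y a h; rewrite ?E; by_functionals; rewrite /k'; ring.
- by br_simp x y a h; rewrite ?E; by_functionals; rewrite /k'; ring.
- by br_simp x y a h; rewrite ?E; by_functionals; ring.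
- by br_simp x y a h; rewrite ?E; by_functionals; rewrite /l; ring.
- by br_simp x y a h; rewrite ?E; by_functionals; ring.
- by br_simp x y a h; rewrite ?E; by_functionals; ring.
- by rewrite (addrC g).
Qed.

Lemma NP4_dim4_core x y a h (p : F) : frame4 x y a h ->
  br x y = a -> br x a = 0 -> br x h = p *: h + y -> br y a = - y ->
  br y h = 0 -> br a h = h -> classified4 L.
Proof.
case=> sp oxy [oxa oxh] [oya oyh] oah xy xa xh ya yh ah.
have E := (xy, xa, xh, ya, yh, ah, oxy, (oxa, oxh, oya, oyh, oah)).
have [p0|p0] := eqVneq p 0.
  rewrite {}p0 scale0r add0r in xh E.
  pick 9.
  have sp' : <<[:: x; a; y; - h]%R>>%VS = fullv.
    by base_change [:: [:: 1; 0; 0; 0]; [:: 0; 0; 1; 0]; [:: 0; 1; 0; 0];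
                       [:: 0; 0; 0; -1]] sp.
  by check_table sp' x y a h E; ring.
pick 11.
have sp' : <<[:: - p^-1 *: x; a; - p *: y; - p ^+ 2 *: h]%R>>%VS = fullv.
  by base_change [:: [:: - p; 0; 0; 0]; [:: 0; 0; - p^-1; 0]; [:: 0; 1; 0; 0];
                     [:: 0; 0; 0; - p ^- 2]] sp.
by check_table sp' x y a h E; field.
Qed.

Lemma NP4_dim4 x y a h (d k m q p : F) : frame4 x y a h -> q != 0 ->
  br x y = d *: y + a + k *: h -> br x a = m *: h -> br x h = q *: y + p *: h ->
  br y a = - y -> br y h = 0 -> br a h = h -> classified4 L.
Proof.
case=> sp oxy [oxa oxh] [oya oyh] oah q0 xy xa xh ya yh ah.
have E := (xy, xa, xh, ya, yh, ah, oxy, (oxa, oxh, oya, oyh, oah)).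
(* Subtracting d a from x removes d y from [x, y]; s and t cancel the y- and h-terms of the new
   [x, a]. *)
pose s := k * q; pose t := m + k * (p - d).
apply: (NP4_dim4_core (x := x - d *: a + s *: y + t *: h) (y := y)
  (a := a + k *: h) (h := q^-1 *: h) (p := p - d)).
- split; try split; om_simp x y a h; rewrite ?E; try ring.
  by base_change [:: [:: 1; - s; d; - q * (d * k + t)]; [:: 0; 1; 0; 0]; [:: 0; 0; 1; - k * q];
                     [:: 0; 0; 0; q]] sp.
- by br_simp x y a h; rewrite ?E; by_functionals; ring.
- by br_simp x y a h; rewrite ?E; by_functionals; rewrite /s /t; ring.
- by br_simp x y a h; rewrite ?E; by_functionals; field.
- by br_simp x y a h; rewrite ?E; by_functionals; ring.
- by br_simp x y a h; rewrite ?E; by_functionals; ring.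
- by br_simp x y a h; rewrite ?E; by_functionals; ring.
Qed.

End Dim4.

Section Dim3.
Variables (F : numClosedFieldType) (L : omegaAlg F).
Hypotheses (Ll : omega_lie L) (dimL : \dim {:L} = 3).
Implicit Types x y v z a h : L.

Definition frame3 x y z : Prop :=
  [/\ <<[:: x; y; z]>>%VS = fullv, om x y = 1, om x z = 0 & om y z = 0].

Local Tactic Notation "base_change" uconstr(M) constr(sp) :=
  refine (@span_change F L M _ _ sp _); by_lin; field.
Local Ltac check_table sp x y z E :=
  apply: (table_iso_eval Ll _ dimL sp) => //;
  (let H := fresh in
  move=> [|[|[|?]]] [|[|[|?]]] H //=; rewrite ?combE /=;
  try (by case/andP: H); clear H);
  rewrite ?(brE Ll) ?(brC Ll y x) ?(brC Ll z x) ?(brC Ll z y)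
    ?(omE Ll) ?(omC Ll y x) ?(omC Ll z x) ?(omC Ll z y) ?E;
  try by_functionals.

Lemma ideal_dim3 x v z (r t : F) : frame3 x v z ->
  br x v = x + r *: z -> br x z = z -> br v z = t *: z -> classified3 L.
Proof.
case=> sp oxv oxz ovz xv xz vz; have E := (xv, xz, vz, oxv, oxz, ovz).
pick 0.
have sp' : <<[:: - v + t *: x + r *: z; x; z]%R>>%VS = fullv.
  by base_change [:: [:: 0; 1; 0]; [:: -1; t; r]; [:: 0; 0; 1]] sp.
by check_table sp' x v z E; ring.
Qed.

Lemma P1_dim3 x v h (r : F) : frame3 x v h ->
  br x v = r *: h + v -> br x h = - h -> br v h = h + x -> classified3 L.
Proof.
case=> sp oxv oxh ovh xv xh vh; have E := (xv, xh, vh, oxv, oxh, ovh).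
pick 2; exists (- r).
have sp' : <<[:: h; x; - v]%R>>%VS = fullv.
  by base_change [:: [:: 0; 1; 0]; [:: 0; 0; -1]; [:: 1; 0; 0]] sp.
by check_table sp' x v h E; ring.
Qed.

Lemma P2_dim3 x y a (b b2 c : F) : frame3 x y a ->
  br x y = a -> br x a = b *: x + b2 *: y -> br y a = c *: y ->
  [/\ b != 0, c != 0, b + c + 1 = 0 & b != c -> b2 = 0] -> classified3 L.
Proof.
case=> sp oxy oxa oya xy xa ya [b0 c0 bc b2P].
have E := (xy, xa, ya, oxy, oxa, oya).
have eb : b = - (1 + c) by apply: (eq_comb bc); ring.
have [b20|b20] := eqVneq b2 0.
  rewrite {}b20 scale0r addr0 in xa E.
  pick 4; exists (b / c); split.
  - by rewrite mulf_neq0 // invr_eq0.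
  - apply: contraPneq bc => bcN; suff -> : b = - c by rewrite addNr add0r; apply/eqP/oner_neq0.
    by rewrite -[b](mulfVK c0) bcN mulN1r.
  have sp' : <<[:: - c^-1 *: a; y; c^-1 *: x]%R>>%VS = fullv.
    by base_change [:: [:: 0; 0; c]; [:: 0; 1; 0]; [:: - c; 0; 0]] sp.
  by check_table sp' x y a E; rewrite ?eb; field.
have ebc : c = b by case: (eqVneq b c) b20 => // /b2P ->; rewrite eqxx.
have n2 : 2 != 0 :> F by rewrite pnatr_eq0.
have b_half : b = - 2^-1.
  by apply: (mulfI n2); apply: (eq_comb bc); rewrite ebc; field.
rewrite {}ebc {}b_half {eb bc b0 c0 b2P} in xa ya E.
have w0 : sqrtC b2 != 0 by rewrite sqrtC_eq0.
have b2E : b2 = sqrtC b2 ^+ 2 by rewrite sqrtCK.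
move: {b20} (sqrtC b2) w0 b2E => w w0 b2E; rewrite {}b2E in xa E.
pick 3.
have sp' : <<[:: 2 *: a; - (2 * w) *: y; w^-1 *: x]%R>>%VS = fullv.
  by base_change [:: [:: 0; 0; w]; [:: 0; - (2 * w)^-1; 0]; [:: 2^-1; 0; 0]] sp.
by check_table sp' x y a E; field.
Qed.

Lemma NP2_dim3 x y a (d : F) : frame3 x y a ->
  br x y = d *: x + a -> br x a = - x -> br y a = 0 -> classified3 L.
Proof.
case=> sp oxy oxa oya xy xa ya; have E := (xy, xa, ya, oxy, oxa, oya).
pick 1.
have sp' : <<[:: - (y + d *: a); a; x]%R>>%VS = fullv.
  by base_change [:: [:: 0; 0; 1]; [:: -1; - d; 0]; [:: 0; 1; 0]] sp.
by check_table sp' x y a E; ring.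
Qed.

End Dim3.

(** * Coordinates for the normal forms in dimensions 3 and 4 *)

Section DimensionCount.
Variables (F : fieldType) (L : omegaAlg F).
Implicit Types (H : {vspace L}) (x y v a h : L).

Lemma dim1_line H : \dim H = 1 -> exists h, H = <[h]>%VS.
Proof.
move=> dH; exists (vpick H); apply/esym/eqP; rewrite eqEdim -memvE memv_pick dH dim_vline.
by rewrite vpick0 -dimv_eq0 dH.
Qed.

Lemma dim_dsum2 H x v : dsum2 H x v -> \dim {:L} = (\dim H).+2.
Proof.
case=> x0 v0 /directvP /= dir sum; rewrite -sum dir /=.
by rewrite !dim_vline x0 v0 !addn1.
Qed.

Lemma dim_dsum3 H x y a : dsum3 H x y a -> \dim {:L} = (\dim H).+3.
Proof.
case=> x0 y0 a0 /directvP /= dir sum; rewrite -sum dir /=.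
by rewrite !dim_vline x0 y0 a0 !addn1.
Qed.

End DimensionCount.
Ltac span_by sum :=
  apply/eqP; rewrite eqEsubv subvf -sum /= !subv_add -?memvE;
  repeat (apply/andP; split); rewrite ?mem0v //;
  by apply: memv_span; rewrite !inE eqxx ?orbT.

Section SmallDimensions.
Variables (F : numClosedFieldType) (L : omegaAlg F).
Hypotheses (Ll : omega_lie L).

Lemma P2_form_dim3 : \dim {:L} = 3 -> P2_form L -> classified3 L.
Proof.
move=> d3; case=> H [x [y [a [h1 [h2 [h3 [b1 [b2 [c1 [fr]]]]]]]]]].
case: fr => ds ah oxy [oxa oya] _ [h1H h2H h3H] bcP [xy xa ya] _.
have /eqP : \dim H = 0 by have := dim_dsum3 ds; rewrite d3 => -[].
rewrite dimv_eq0 => /eqP H0; rewrite {}H0 in ds h1H h2H h3H *.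
move: h1H h2H h3H; rewrite !memv0 => /eqP E1 /eqP E2 /eqP E3.
rewrite {}E1 {}E2 {}E3 !add0r in xy xa ya.
have [_ _ _ _ sum] := ds.
apply: (P2_dim3 Ll d3 (x := x) (y := y) (a := a)) bcP => //.
by split=> //; span_by sum.
Qed.

Lemma P2_form_dim4 : \dim {:L} = 4 -> P2_form L -> classified4 L.
Proof.
move=> d4; case=> H [x [y [a [h1 [h2 [h3 [b1 [b2 [c1 [fr]]]]]]]]]].
case: fr => ds ah oxy [oxa oya] [nH nx ny na] [h1H h2H h3H] bcP [xy xa ya] [xH yH].
have /dim1_line[h Hh] : \dim H = 1 by have := dim_dsum3 ds; rewrite d4 => -[].
have hH : h \in H by rewrite Hh memv_line.
move: h1H h2H h3H; rewrite Hh => /vlineP[m E1] /vlineP[n E2] /vlineP[k E3].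
have [_ _ _ _ sum] := ds; rewrite Hh in sum.
apply: (P2_dim4 Ll d4 (x := x) (y := y) (a := a) (h := h) (m := m) (n := n) (k := k)) bcP.
- by split; [span_by sum | | rewrite (nx h) | rewrite (ny h) | rewrite (na h)].
- by rewrite xy E3.
- by rewrite xa E1.
- by rewrite xH.
- by rewrite ya E2.
- by rewrite yH.
- by rewrite ah.
Qed.

Lemma NP2_form_dim3 : \dim {:L} = 3 -> NP2_form L -> classified3 L.
Proof.
move=> d3; case=> H [x [y [a [h1 [h2 [h3 [d1 [fr]]]]]]]].
case: fr => ds ah oxy [oxa oya] _ [h1H h2H h3H] _ _ [ya xy xa _].
have /eqP : \dim H = 0 by have := dim_dsum3 ds; rewrite d3 => -[].
rewrite dimv_eq0 => /eqP H0; rewrite {}H0 in ds h1H h2H h3H *.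
move: h1H h2H h3H; rewrite !memv0 => /eqP E1 /eqP E2 /eqP E3.
rewrite {}E1 {}E2 {}E3 !add0r in xy xa ya.
have [_ _ _ _ sum] := ds.
apply: (NP2_dim3 Ll d3 (x := x) (y := y) (a := a)) xy xa ya.
by split=> //; span_by sum.
Qed.

Lemma NP2_form_dim4 : \dim {:L} = 4 -> NP2_form L -> classified4 L.
Proof.
move=> d4; case=> H [x [y [a [h1 [h2 [h3 [d1 [fr]]]]]]]].
case: fr => ds ah oxy [oxa oya] [nH nx ny na] [h1H h2H h3H] xH yH [ya xy xa rel].
have dH : \dim H = 1 by have := dim_dsum3 ds; rewrite d4 => -[].
have /dim1_line[h Hh] := dH.
have hH : h \in H by rewrite Hh memv_line.
have h0 : h != 0 by move: dH; rewrite Hh dim_vline; case: eqP.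
have [g yh] : exists g, br y h = g *: h by apply/vlineP; rewrite -Hh yH.
move: h1H h2H h3H; rewrite Hh => /vlineP[m E1] /vlineP[n E2] /vlineP[k E3].
have [_ _ _ _ sum] := ds; rewrite Hh in sum.
apply: (NP2_dim4 Ll d4 (x := x) (y := y) (a := a) (h := h) (m := m) (n := n) (k := k)
  (d := d1) (g := g)).
- by split; [span_by sum | | rewrite (nx h) | rewrite (ny h) | rewrite (na h)].
- by rewrite xy E3.
- by rewrite xa E1.
- by rewrite xH.
- by rewrite ya E2.
- exact: yh.
- by rewrite ah.
move: rel; rewrite E1 (brZr Ll) yh !scalerA -scalerDl => /eqP.
rewrite scaler_eq0 (negPf h0) orbF => /eqP <-; ring.
Qed.

Lemma NP4_form_dim4 : \dim {:L} = 4 -> NP4_form L -> classified4 L.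
Proof.
move=> d4; case=> H [x [y [a [h3 [h4 [d1 [fr [h3H h4H] [xH [k kH pk] yH] [ya xa xy]]]]]]]].
case: fr => ds ah oxy [oxa oya] [nH nx ny na].
have /dim1_line[h Hh] : \dim H = 1 by have := dim_dsum3 ds; rewrite d4 => -[].
have hH : h \in H by rewrite Hh memv_line.
have [p xh] : exists p, br x h - om x (br x h) *: y = p *: h by apply/vlineP; rewrite -Hh xH.
have q0 : om x (br x h) != 0.
  move: kH pk; rewrite Hh => /vlineP[c ->]; rewrite (brZr Ll) (omZr Ll) mulf_eq0.
  by rewrite negb_or => /andP[].
move: h3H h4H; rewrite Hh => /vlineP[l h3E] /vlineP[m h4E].
have [_ _ _ _ sum] := ds; rewrite Hh in sum.
apply: (NP4_dim4 Ll d4 (x := x) (y := y) (a := a) (h := h) (d := d1) (k := l) (m := m)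
  (p := p) _ q0).
- by split; [span_by sum | | rewrite (nx h) | rewrite (ny h) | rewrite (na h)].
- by rewrite xy h3E.
- by rewrite xa h4E.
- by rewrite -xh addrC subrK.
- exact: ya.
- by rewrite yH.
- by rewrite ah.
Qed.

Lemma NP4_form_dim_gt3 : NP4_form L -> (3 < \dim {:L})%N.
Proof.
case=> H [x [y [a [_ [_ [_ [[ds _ _ _ _] _ [_ [k kH pk] _] _]]]]]]].
rewrite (dim_dsum3 ds) !ltnS lt0n dimv_eq0; apply: contraNneq pk => H0.
by move: kH; rewrite H0 memv0 => /eqP ->; rewrite (br0r Ll) (om0r Ll).
Qed.

Lemma P1_dim_lineH2 (H1 : {vspace L}) (h0 x v : L) :
  [/\ h0 != 0, x != 0, v != 0, directv (<[h0]> + H1 + <[x]> + <[v]>)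
    & (<[h0]> + H1 + <[x]> + <[v]>)%VS = fullv] -> \dim {:L} = (\dim H1).+3.
Proof.
case=> h00 x0 v0 /directvP /= dir sum; rewrite -sum dir /=.
by rewrite !dim_vline h00 x0 v0 !addn1.
Qed.

Lemma P1_form_dim3 : \dim {:L} = 3 -> P1_form L -> classified3 L.
Proof.
move=> d3; case=> H1 [h0 [x [v [h1 [h2 [ds [h1H h2H] [xh vH vh xv oxv] [xH nR nx nv]]]]]]].
have /eqP : \dim H1 = 0 by have := P1_dim_lineH2 ds; rewrite d3 => -[].
rewrite dimv_eq0 => /eqP H0; have [_ _ _ _ sum] := ds.
rewrite H0 addv0 in sum h1H nx nv; move: h2H; rewrite H0 memv0 => /eqP h20.
have [r h1E] := vlineP _ _ h1H; rewrite h1E in xv; rewrite h20 add0r in vh.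
apply: (P1_dim3 Ll d3 (x := x) (v := v) (h := h0)) xv xh vh.
by split; [span_by sum | | rewrite nx ?memv_line | rewrite nv ?memv_line].
Qed.

Lemma P1_form_dim4 : \dim {:L} = 4 -> P1_form L -> classified4 L.
Proof.
move=> d4; case=> H1 [h0 [x [v [h1 [h2 [ds [h1H h2H] [xh vH vh xv oxv] [xH nR nx nv]]]]]]].
have /dim1_line[e He] : \dim H1 = 1 by have := P1_dim_lineH2 ds; rewrite d4 => -[].
have [_ _ _ _ sum] := ds; rewrite {}He {ds} in sum h1H h2H vH xH nR nx nv.
have [k h2E] := vlineP _ _ h2H; rewrite h2E in vh.
have [_ /vlineP[r0 ->] [_ /vlineP[r1 ->] h1E]] := memv_addP h1H; rewrite h1E in xv.
have h0R : h0 \in (<[h0]> + <[e]>)%VS by rewrite (subvP (addvSl _ _)) ?memv_line.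
have eR : e \in (<[h0]> + <[e]>)%VS by rewrite (subvP (addvSr _ _)) ?memv_line.
apply: (P1_dim4 Ll d4 _ xv xh _ vh).
- by split; [span_by sum | | rewrite !nx | rewrite !nv | have [] := nR _ _ h0R eR].
- by rewrite xH ?memv_line.
- by rewrite vH ?memv_line.
- by have [] := nR _ _ h0R eR.
Qed.

Lemma ideal_form_dim3 : \dim {:L} = 3 -> ideal_form L -> classified3 L.
Proof.
move=> d3; case=> H [x [v [ds oxv [nH nx nv] xvH [xH vH rel]]]].
have dH : \dim H = 1 by have := dim_dsum2 ds; rewrite d3 => -[].
have /dim1_line[h Hh] := dH.
have h0 : h != 0 by move: dH; rewrite Hh dim_vline; case: eqP.
have hH : h \in H by rewrite Hh memv_line.
have [c xh] : exists c, br x h = c *: h by apply/vlineP; rewrite -Hh xH.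
have [t vh] : exists c, br v h = c *: h by apply/vlineP; rewrite -Hh vH.
have [r xv] : exists c, br x v - x = c *: h by apply/vlineP; rewrite -Hh.
have c1 : c = 1.
  have := rel h hH; rewrite xh vh !(brZr Ll) xh vh => E.
  have : (c - 1) *: h = 0.
    by apply: (eq_comb E); by_functionals; ring.
  by move/eqP; rewrite scaler_eq0 (negPf h0) orbF subr_eq0 => /eqP.
have [_ _ _ sum] := ds; rewrite Hh in sum.
apply: (ideal_dim3 Ll d3 (x := x) (v := v) (z := h) (r := r) (t := t)) => //.
- by split; [span_by sum | | rewrite nx | rewrite nv].
- by rewrite -xv addrC subrK.
- by rewrite xh c1 scale1r.
Qed.

Lemma ideal_flag (H : {vspace L}) (x v : L) (n : nat) :
  {in H, forall h, br x h \in H} -> {in H, forall h, br v h \in H} ->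
  {in H, forall h, br x h - br x (br v h) + br v (br x h) = h} -> \dim H = n ->
  exists b : n.-tuple L, basis_of H b /\ forall j, (j < n)%N ->
    br x b`_j - b`_j \in <<take j b>>%VS /\ br v b`_j \in <<take j.+1 b>>%VS.
Proof.
move=> xH vH rel dH.
have [f fE] := restrict_end (br_linearr Ll x) xH.
have [g gE] := restrict_end (br_linearr Ll v) vH.
have dimH : \dim {:subvs_of H} = n by rewrite dimvf.
have [b [bb flag]] := flag_basis (ideal_form_commutator fE gE rel) dimH.
have vals (u : subvs_of H) s : u \in <<s>>%VS -> vsval u \in <<map vsval s>>%VS.
  rewrite -(in_tupleE s) => /coord_span ->; rewrite linear_sum memv_suml // => i _.
  by rewrite linearZ memvZ // memv_span // map_f // mem_nth.
exists (map_tuple vsval b); split=> [|j jn].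
  rewrite basisEdim size_tuple dH leqnn andbT; apply/subvP => u uH.
  by rewrite -(vsprojK uH); apply: vals; rewrite (span_basis bb) memvf.
have [Nj gj] := flag j jn; rewrite (nth_map 0) ?size_tuple // -!map_take fE gE.
split; last exact: vals.
by have := vals _ _ Nj; rewrite !(add_lfunE, opp_lfunE, id_lfunE) linearB.
Qed.

Lemma ideal_form_dim4 : \dim {:L} = 4 -> ideal_form L -> classified4 L.
Proof.
move=> d4; case=> H [x [v [ds oxv [nH nx nv] xvH [xH vH rel]]]].
have dH : \dim H = 2 by have := dim_dsum2 ds; rewrite d4 => -[].
have [b [bb flag]] := ideal_flag xH vH rel dH.
have [z [e bE]] : exists z e, b = [:: z; e] :> seq L.
  by move: b {bb flag} => [[|z [|e []]] //= _]; exists z, e.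
have [_ _ _ sum] := ds; rewrite -(span_basis bb) bE span_cons span_seq1 in sum.
have zH : z \in H by apply: (basis_mem bb); rewrite bE mem_head.
have eH : e \in H by apply: (basis_mem bb); rewrite bE !inE eqxx orbT.
have z0 : z != 0 by apply: (basis_not0 bb); rewrite bE mem_head.
have e0 : e != 0 by apply: (basis_not0 bb); rewrite bE !inE eqxx orbT.
have H2 u : u \in H -> exists r0 r1, u = r0 *: z + r1 *: e.
  rewrite -(span_basis bb) bE span_cons span_seq1.
  move=> /memv_addP[_ /vlineP[r0 ->] [_ /vlineP[r1 ->] ->]].
  by exists r0, r1.
move: flag; rewrite bE => flag.
have /= [] := flag 0 isT; rewrite span_nil memv0 subr_eq0 span_seq1 => /eqP xz /vlineP[p vz].
have /= [] := flag 1 isT; rewrite span_seq1 => /vlineP[s xe] veH.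
have {}xe : br x e = e + s *: z by rewrite -xe addrC subrK.
have [q [t ve]] := H2 _ (vH _ eH).
have [r0 [r1 xv]] := H2 _ xvH.
have {}xv : br x v = x + (r0 *: z + r1 *: e) by rewrite -xv addrC subrK.
have ze : br z e = 0 by have [] := nH _ _ zH eH.
have oze : om z e = 0 by have [] := nH _ _ zH eH.
have st : s * (t - p - 1) = 0.
  have := rel e eH; rewrite xe ve !(brDr Ll) !(brZr Ll) xz xe vz ve => E.
  have : (s * (t - p - 1)) *: z = 0.
    by apply: (eq_comb (esym E)); by_functionals; ring.
  by move/eqP; rewrite scaler_eq0 (negPf z0) orbF => /eqP.
(* Subtracting p x makes v kill z, and adding c z - r1 e restores [x, v'] = x. *)
pose c := r1 * s - r0.
pose v' := v - p *: x + c *: z - r1 *: e.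
have xz' : br z x = - z by rewrite (brC Ll) xz.
have xe' : br e x = - (e + s *: z) by rewrite (brC Ll) xe.
have ze' : br e z = 0 by rewrite (brC Ll) ze oppr0.
apply: (ideal_dim4 Ll d4 (x := x) (v := v') (z := z) (e := e) (s := s)
  (q := q - p * s) (t := t - p)) => //.
- split; rewrite /v' ?(omE Ll) ?(nx _ zH) ?(nx _ eH) ?(nv _ zH) ?(nv _ eH) ?oxv ?oze
    ?(omC Ll e z) ?oze; try (by ring); try (by split; ring).
  apply: (@span_change F L [:: [:: 1; 0; 0; 0]; [:: p; 1; - c; r1]; [:: 0; 0; 1; 0];
    [:: 0; 0; 0; 1]] [:: x; v; z; e]); first by span_by sum.
  by congr [:: _; _; _; _]; by_functionals; ring.
- by rewrite /v' !(brE Ll) xv xz xe; by_functionals; rewrite /c; ring.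
- by rewrite /v' !(brE Ll) vz xz ze'; by_functionals; ring.
- by rewrite /v' !(brE Ll) ve xe ze; by_functionals; ring.
Qed.

Lemma normal_forms_dim3 : nontrivial L -> \dim {:L} = 3 -> classified3 L.
Proof.
move=> Lnt d3; have dim_gt2 : (2 < \dim {:L})%N by rewrite d3.
case: (normal_forms Ll Lnt dim_gt2) => [||[]].
- exact: ideal_form_dim3.
- exact: P1_form_dim3.
- exact: P2_form_dim3.
- exact: NP2_form_dim3.
- by move/NP4_form_dim_gt3; rewrite d3.
Qed.

Lemma normal_forms_dim4 : nontrivial L -> \dim {:L} = 4 -> classified4 L.
Proof.
move=> Lnt d4; have dim_gt2 : (2 < \dim {:L})%N by rewrite d4.
case: (normal_forms Ll Lnt dim_gt2) => [||[]].
- exact: ideal_form_dim4.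
- exact: P1_form_dim4.
- exact: P2_form_dim4.
- exact: NP2_form_dim4.
- exact: NP4_form_dim4.
Qed.

End SmallDimensions.

Theorem theorem1p1 (R : realType) (L : omegaAlg R[i])
    (L_omega_lie : omega_lie L) (L_nontrivial : nontrivial L)
    (L_dim : (3 <= \dim {:L})%N) :
  (\dim {:L} = 3%N /\ classified3 L) \/
  (\dim {:L} = 4%N /\ classified4 L) \/
  ((5 <= \dim {:L})%N /\ NP1_type L) \/
  ((5 <= \dim {:L})%N /\ P1_type L) \/
  ((5 <= \dim {:L})%N /\ NP2_type L) \/
  ((5 <= \dim {:L})%N /\ NP3_type L) \/
  ((5 <= \dim {:L})%N /\ P2_type L) \/
  ((5 <= \dim {:L})%N /\ NP4_type L).
Proof.
have [d3|] := eqVneq (\dim {:L}) 3%N.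
  by left; split=> //; exact: normal_forms_dim3.
have [d4 _|d4 d3] := eqVneq (\dim {:L}) 4%N.
  by right; left; split=> //; exact: normal_forms_dim4.
have d5 : (5 <= \dim {:L})%N.
  by rewrite ltn_neqAle eq_sym d4 ltn_neqAle eq_sym d3.
do 2 right.
case: (normal_forms L_omega_lie L_nontrivial L_dim) => [nf|nf|[] nf].
- by left; split=> //; exact: ideal_form_type nf.
- by right; left; split=> //; exact: P1_form_type nf.
- by do 4 right; left; split=> //; exact: P2_form_type nf.
- by do 2 right; left; split=> //; exact: NP2_form_type nf.
- by do 5 right; split=> //; exact: NP4_form_type nf.
Qed.
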